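(* Let $\mathbb{W}$ be a union of lines and ACM points in $\mathbb{P}^1\times\mathbb{P}^1$, let $I=I_{\mathbb{W}}$, and let $\mathcal{G}(I)=A\sqcup B$ be a partition of its standard generating set into nonempty sets. Let $J=\langle A\rangle$ and $K=\langle B\rangle$. Then $J\cap K$ is the defining ideal of a union of lines and ACM points.
   Context: $R=\mathbb{C}[x_0,x_1,y_0,y_1]$ is bigraded with $\deg x_i=(1,0)$, $\deg y_i=(0,1)$. For $A=[a_0:a_1]\in\mathbb{P}^1$ let $H_A=a_1x_0-a_0x_1$ and for $B=[b_0:b_1]$ let $V_B=b_1y_0-b_0y_1$; the same symbol denotes the form and its zero set (horizontal, resp. vertical, line or ruling). $I_{A\times B}=\langle H_A,V_B\rangle$, $I_{\mathbb{X}}=\bigcap_{P\in\mathbb{X}}I_P$, and a finite set $\mathbb{X}$ is ACM if $R/I_{\mathbb{X}}$ is Cohen–Macaulay. A union of lines and points is $\mathbb{W}=\{P_1,\dots,P_r,H_1,\dots,H_t,V_1,\dots,V_p\}$ (distinct points, horizontal lines and vertical lines, no point on any of the lines), with $\mathbb{X}_{\mathbb{W}}=\{P_1,\dots,P_r\}$ and $I_{\mathbb{W}}=\bigcap_iI_{P_i}\cap\bigcap_i\langle H_i\rangle\cap\bigcap_j\langle V_j\rangle$; it is a union of lines and ACM points if $\mathbb{X}_{\mathbb{W}}$ is ACM (only lines or only points allowed). For ACM $\mathbb{X}$ with $\pi_1(\mathbb{X})=\{A_1,\dots,A_h\}$, $\pi_2(\mathbb{X})=\{B_1,\dots,B_v\}$,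 labelled so that $\alpha_i=|\{P\in\mathbb{X}:P\in H_{A_i}\}|$ satisfies $\alpha_1\ge\cdots\ge\alpha_h$ and the counts on $V_{B_j}$ are nonincreasing, $I_{\mathbb{X}}$ is minimally generated by $\{H_{A_1}\cdots H_{A_h},\ V_{B_1}\cdots V_{B_v}\}\cup\{H_{A_1}\cdots H_{A_i}V_{B_1}\cdots V_{B_{\alpha_{i+1}}}:\alpha_{i+1}<\alpha_i\}$ (unique up to nonzero scalars). The standard generating set of $I_{\mathbb{W}}$ is this set for $\mathbb{X}=\mathbb{X}_{\mathbb{W}}$, each element multiplied by $\Lambda=\prod_iH_i\prod_jV_j$. *)

(* Defs.v *)
From HB Require Import structures.
From mathcomp Require Import all_boot all_order all_algebra.
From mathcomp Require Import Rstruct.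
From mathcomp Require Import complex.
From mathcomp Require Import mpoly.

Set Implicit Arguments.
Unset Strict Implicit.
Unset Printing Implicit Defensive.

Import GRing.Theory.
Local Open Scope ring_scope.

Definition CC : closedFieldType := (Rdefinitions.R)[i].

Notation RR := {mpoly CC[4]}.
Definition x0 : RR := 'X_0.
Definition x1 : RR := 'X_1.
Definition y0 : RR := 'X_2.
Definition y1 : RR := 'X_3.

(* A point [a0:a1] of P^1 is given by a coordinate pair (a0,a1) <> (0,0). *)
Definition P1pt := (CC * CC)%type.
Definition nzP1 (a : P1pt) : bool := (a.1 != 0) || (a.2 != 0).
Definition sameP1 (a b : P1pt) : bool := a.1 * b.2 == a.2 * b.1.

Definition Hf (a : P1pt) : RR := a.2 *: x0 - a.1 *: x1.
Definition Vf (b : P1pt) : RR := b.2 *: y0 - b.1 *: y1.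

Definition P1P1pt := (P1pt * P1pt)%type.
Definition onH (a : P1pt) (P : P1P1pt) : bool := sameP1 a P.1.
Definition onV (b : P1pt) (P : P1P1pt) : bool := sameP1 b P.2.

Definition is_ideal (I : RR -> Prop) : Prop :=
  I 0 /\ (forall a b, I a -> I b -> I (a + b)) /\ (forall r a, I a -> I (r * a)).

Definition ideal_gen (s : seq RR) : RR -> Prop :=
  fun p => exists c : 'I_(size s) -> RR, p = \sum_(i < size s) c i * nth 0 s i.

Definition ideal_add (I : RR -> Prop) (s : seq RR) : RR -> Prop :=
  fun p => exists q, I q /\ ideal_gen s (p - q).

Definition prime_ideal (P : RR -> Prop) : Prop :=
  is_ideal P /\ ~ P 1 /\ (forall a b, P (a * b) -> P a \/ P b).

Definition irrelevant : RR -> Prop := ideal_gen [:: x0; x1; y0; y1].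

Definition regular_seq (I : RR -> Prop) (f : seq RR) : Prop :=
  (forall g, g \in f -> irrelevant g) /\
  (forall i, (i < size f)%N -> forall g,
      ideal_add I (take i f) (nth 0 f i * g) -> ideal_add I (take i f) g) /\
  ~ ideal_add I f 1.

Definition depth_eq (I : RR -> Prop) (n : nat) : Prop :=
  (exists f, size f = n /\ regular_seq I f) /\
  (forall f, regular_seq I f -> (size f <= n)%N).

(* a chain P_0 < P_1 < ... < P_n of prime ideals of R containing I
   (= a chain of primes of R/I of length n) *)
Definition prime_chain (I : RR -> Prop) (n : nat) (P : nat -> RR -> Prop) : Prop :=
  (forall k, (k <= n)%N -> prime_ideal (P k) /\ (forall p, I p -> P k p)) /\
  (forall k, (k < n)%N ->
     (forall p, P k p -> P k.+1 p) /\ (exists p, P k.+1 p /\ ~ P k p)).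

Definition dim_eq (I : RR -> Prop) (n : nat) : Prop :=
  (exists P, prime_chain I n P) /\ (forall m P, prime_chain I m P -> (m <= n)%N).

(* R/I is Cohen-Macaulay (graded ring: depth w.r.t. m = Krull dimension) *)
Definition CohenMacaulay (I : RR -> Prop) : Prop :=
  exists n, depth_eq I n /\ dim_eq I n.

Definition I_pt (P : P1P1pt) : RR -> Prop := ideal_gen [:: Hf P.1; Vf P.2].

Definition I_X (X : seq P1P1pt) : RR -> Prop :=
  fun p => forall P, P \in X -> I_pt P p.

Definition ACM (X : seq P1P1pt) : Prop := CohenMacaulay (I_X X).

Record ULP := MkULP { pts : seq P1P1pt; hlines : seq P1pt; vlines : seq P1pt }.

Definition is_ULP (W : ULP) : Prop :=
  (forall P, P \in pts W -> nzP1 P.1 && nzP1 P.2) /\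
  (forall a, a \in hlines W -> nzP1 a) /\
  (forall b, b \in vlines W -> nzP1 b) /\
  pairwise (fun P Q : P1P1pt => ~~ (sameP1 P.1 Q.1 && sameP1 P.2 Q.2)) (pts W) /\
  pairwise (fun a b => ~~ sameP1 a b) (hlines W) /\
  pairwise (fun a b => ~~ sameP1 a b) (vlines W) /\
  (forall P a, P \in pts W -> a \in hlines W -> ~~ onH a P) /\
  (forall P b, P \in pts W -> b \in vlines W -> ~~ onV b P).

Definition I_W (W : ULP) : RR -> Prop :=
  fun p => I_X (pts W) p /\
           (forall a, a \in hlines W -> ideal_gen [:: Hf a] p) /\
           (forall b, b \in vlines W -> ideal_gen [:: Vf b] p).

(* union of lines and ACM points (X_W ACM; X_W empty = only lines allowed) *)
Definition is_ULAP (W : ULP) : Prop :=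
  is_ULP W /\ (pts W = [::] \/ ACM (pts W)).

Definition alpha (X : seq P1P1pt) (a : P1pt) : nat := count (onH a) X.
Definition beta (X : seq P1P1pt) (b : P1pt) : nat := count (onV b) X.

(* As = [A_1;..;A_h] labels pi_1(X), Bs = [B_1;..;B_v] labels pi_2(X), with
   nonincreasing point counts on the corresponding lines *)
Definition std_labeling (X : seq P1P1pt) (As Bs : seq P1pt) : Prop :=
  (forall a, a \in As -> nzP1 a) /\
  pairwise (fun a b => ~~ sameP1 a b) As /\
  (forall P, P \in X -> has (fun a => onH a P) As) /\
  (forall a, a \in As -> has (onH a) X) /\
  sorted geq [seq alpha X a | a <- As] /\
  (forall b, b \in Bs -> nzP1 b) /\
  pairwise (fun a b => ~~ sameP1 a b) Bs /\
  (forall P, P \in X -> has (fun b => onV b P) Bs) /\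
  (forall b, b \in Bs -> has (onV b) X) /\
  sorted geq [seq beta X b | b <- Bs].

Definition P1zero : P1pt := (0, 0).

Definition prodH (As : seq P1pt) (k : nat) : RR := \prod_(a <- take k As) Hf a.
Definition prodV (Bs : seq P1pt) (k : nat) : RR := \prod_(b <- take k Bs) Vf b.

(* {H_A1..H_Ah, V_B1..V_Bv} u {H_A1..H_Ai V_B1..V_B(alpha_(i+1)) : alpha_(i+1) < alpha_i},
   1 <= i <= h-1 (here with 0-based index j = i-1) *)
Definition std_gens_X (X : seq P1P1pt) (As Bs : seq P1pt) : seq RR :=
  [:: prodH As (size As); prodV Bs (size Bs)] ++
  [seq prodH As j.+1 * prodV Bs (alpha X (nth P1zero As j.+1))
    | j <- iota 0%N (size As).-1 &
      (alpha X (nth P1zero As j.+1) < alpha X (nth P1zero As j))%N].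

Definition Lambda (W : ULP) : RR :=
  (\prod_(a <- hlines W) Hf a) * (\prod_(b <- vlines W) Vf b).

Definition std_gens (W : ULP) (As Bs : seq P1pt) : seq RR :=
  [seq Lambda W * g | g <- std_gens_X (pts W) As Bs].

(* Main.v *)
Require Import Defs.
From HB Require Import structures.
From mathcomp Require Import all_boot all_order all_algebra.
From mathcomp Require Import Rstruct complex mpoly.
From mathcomp Require Import ring zify.

(** Absorbing [Lambda] into the lists of rulings, every standard generator has
    the form H_0 ... H_(s-1) V_0 ... V_(t-1).  An ideal generated by finitely
    many such products is a polarized monomial ideal in two variables: it
    consists of the forms vanishing on the rulings and on the points (i, j)
    outside the up-set U spanned by the exponents (s, t).  Hence J and K meet in
    the ideal attached to the intersection of the two up-sets, which is again a
    set of lines together with a staircase of points.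

    A staircase X is ACM.  Depth at least 2: peeling off one ruling at a time
    shows that a general horizontal form followed by a general vertical form is
    a regular sequence.  Depth and dimension at most 2: any three elements are
    algebraically dependent modulo I_X, and the lowest term of such a relation,
    written as in the Coquand-Lombardi characterization of Krull dimension,
    bounds both regular sequences and chains of primes. *)

Set Implicit Arguments.
Unset Strict Implicit.
Unset Printing Implicit Defensive.

Import GRing.Theory.
Local Open Scope ring_scope.

(** * Ideals *)

Lemma ideal0 (I : RR -> Prop) : is_ideal I -> I 0.
Proof. by case. Qed.

Lemma idealD (I : RR -> Prop) p q : is_ideal I -> I p -> I q -> I (p + q).
Proof. by case=> _ [+ _]; apply. Qed.

Lemma idealM (I : RR -> Prop) r p : is_ideal I -> I p -> I (r * p).
Proof. by case=> _ [_]; apply. Qed.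

Lemma ideal_mulr (I : RR -> Prop) r p : is_ideal I -> I p -> I (p * r).
Proof. by move=> hI Ip; rewrite mulrC; apply: idealM. Qed.

Lemma idealN (I : RR -> Prop) p : is_ideal I -> I p -> I (- p).
Proof. by move=> hI Ip; rewrite -mulN1r; apply: idealM. Qed.

Lemma idealB (I : RR -> Prop) p q : is_ideal I -> I p -> I q -> I (p - q).
Proof. by move=> hI Ip Iq; apply: idealD => //; apply: idealN. Qed.

Lemma ideal_sum (I : RR -> Prop) (J : Type) (r : seq J) (P : pred J) F :
  is_ideal I -> (forall j, P j -> I (F j)) -> I (\sum_(j <- r | P j) F j).
Proof.
move=> hI IF; apply: big_ind => //; first exact: ideal0.
by move=> x y; apply: idealD.
Qed.

Lemma ideal_gen_nil p : ideal_gen [::] p <-> p = 0.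
Proof.
split=> [[c ->]|->]; first by rewrite big_ord0.
by exists (fun=> 0); rewrite big_ord0.
Qed.

Lemma ideal_gen_cons g s p :
  ideal_gen (g :: s) p <-> exists c q, p = c * g + q /\ ideal_gen s q.
Proof.
split=> [[c ->]|[c [q [-> [d ->]]]]].
  exists (c ord0), (\sum_(i < size s) c (lift ord0 i) * nth 0 s i).
  by rewrite big_ord_recl; split=> //; exists (fun i => c (lift ord0 i)).
exists (fun i => if unlift ord0 i is Some j then d j else c).
rewrite [RHS]big_ord_recl unlift_none; congr (_ + _).
by apply: eq_bigr => i _; rewrite liftK.
Qed.

Lemma ideal_gen1 g p : ideal_gen [:: g] p <-> exists c, p = c * g.
Proof.
rewrite ideal_gen_cons; split=> [[c [q [-> /ideal_gen_nil ->]]]|[c ->]].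
  by exists c; rewrite addr0.
by exists c, 0; rewrite addr0; split=> //; apply/ideal_gen_nil.
Qed.

Lemma ideal_gen2 g h p :
  ideal_gen [:: g; h] p <-> exists c d, p = c * g + d * h.
Proof.
rewrite ideal_gen_cons; split=> [[c [q [-> /ideal_gen1 [d ->]]]]|[c [d ->]]].
  by exists c, d.
by exists c, (d * h); split=> //; apply/ideal_gen1; exists d.
Qed.

Lemma ideal_gen_ideal s : is_ideal (ideal_gen s).
Proof.
split; [|split].
- by exists (fun=> 0); rewrite big1 // => i _; rewrite mul0r.
- move=> _ _ [c ->] [d ->]; exists (fun i => c i + d i).
  by rewrite -big_split; apply: eq_bigr => i _; rewrite mulrDl.
- move=> r _ [c ->]; exists (fun i => r * c i).
  by rewrite mulr_sumr; apply: eq_bigr => i _; rewrite mulrA.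
Qed.

Lemma mem_ideal_gen s g : g \in s -> ideal_gen s g.
Proof.
elim: s => // h s IH; rewrite inE => /predU1P[->|/IH gs]; apply/ideal_gen_cons.
  by exists 1, 0; rewrite mul1r addr0; split=> //; exact: (ideal0 (ideal_gen_ideal _)).
by exists 0, g; rewrite mul0r add0r.
Qed.

Lemma ideal_gen_sub s (I : RR -> Prop) :
  is_ideal I -> (forall g, g \in s -> I g) -> forall p, ideal_gen s p -> I p.
Proof.
move=> hI sI _ [c ->]; apply: ideal_sum => // i _.
by apply: idealM => //; apply: sI; rewrite mem_nth.
Qed.

Lemma ideal_add_ideal I s : is_ideal I -> is_ideal (ideal_add I s).
Proof.
have hs := ideal_gen_ideal s; move=> hI; split; [|split].
- by exists 0; split; [exact: ideal0 | rewrite subrr; exact: ideal0].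
- move=> p q [p' [Ip sp]] [q' [Iq sq]]; exists (p' + q').
  by split; [exact: idealD | rewrite opprD addrACA; exact: idealD].
- move=> r p [p' [Ip sp]]; exists (r * p').
  by split; [exact: idealM | rewrite -mulrBr; exact: idealM].
Qed.

Lemma ideal_add_r I s p : is_ideal I -> ideal_gen s p -> ideal_add I s p.
Proof. by move=> hI sp; exists 0; rewrite subr0; split=> //; apply: ideal0. Qed.

Lemma I_X_ideal X : is_ideal (I_X X).
Proof.
split; [|split].
- by move=> P _; exact: (ideal0 (ideal_gen_ideal _)).
- by move=> p q Ip Iq P PX; exact: (idealD (ideal_gen_ideal _) (Ip P PX) (Iq P PX)).
- by move=> r p Ip P PX; exact: (idealM _ (ideal_gen_ideal _) (Ip P PX)).
Qed.

(** Congruence modulo an ideal respects sums, products and powers, so it spreads from the variables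
    to all polynomials. *)
Lemma alg_endo_congr (f : {lrmorphism RR -> RR}) (I : RR -> Prop) :
  is_ideal I -> (forall i, I ('X_i - f 'X_i)) -> forall p, I (p - f p).
Proof.
move=> hI It.
have powB (x y : RR) k : I (x - y) -> I (x ^+ k - y ^+ k).
  move=> xy; elim: k => [|k IH]; first by rewrite !expr0 subrr; apply: ideal0.
  rewrite !exprS.
  rewrite (_ : _ - _ = x * (x ^+ k - y ^+ k) + y ^+ k * (x - y)); last by ring.
  exact: (idealD hI (idealM _ hI IH) (idealM _ hI xy)).
elim/mpolyind => [|c m p _ _ Ip].
  by rewrite rmorph0 subrr; apply: ideal0.
rewrite rmorphD /= opprD addrACA; refine (idealD hI _ Ip).
rewrite linearZ -scalerBr -mul_mpolyC; refine (idealM _ hI _).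
rewrite mpolyXE_id rmorph_prod.
apply: (big_ind2 (fun x y => I (x - y))) => [|x1 x2 y1 y2 I1 I2|i _].
- by rewrite subrr; apply: ideal0.
- rewrite (_ : _ - _ = y1 * (x1 - x2) + x2 * (y1 - y2)); last by ring.
  by refine (idealD hI (idealM _ hI I1) (idealM _ hI I2)).
- by rewrite rmorphXn; apply: powB.
Qed.

Lemma ord4_ind (P : 'I_4 -> Prop) : P 0 -> P 1 -> P 2 -> P 3 -> forall i, P i.
Proof.
move=> P0 P1 P2 P3 [[|[|[|[|//]]]] lti].
- by rewrite (_ : Ordinal lti = 0) //; apply: val_inj.
- by rewrite (_ : Ordinal lti = 1) //; apply: val_inj.
- by rewrite (_ : Ordinal lti = 2) //; apply: val_inj.
- by rewrite (_ : Ordinal lti = 3) //; apply: val_inj.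
Qed.

Lemma mem_second (T : eqType) (a b : T) s : b \in [:: a, b & s].
Proof. by rewrite !inE eqxx orbT. Qed.

Lemma mem_third (T : eqType) (a b c : T) s : c \in [:: a, b, c & s].
Proof. by rewrite !inE eqxx !orbT. Qed.

Lemma sub_insert_second (T : eqType) (a b c : T) :
  {subset [:: a; c] <= [:: a; b; c]}.
Proof. by move=> x; rewrite !inE => /orP[] ->; rewrite ?orbT. Qed.

(* [ideal_gen s] is the kernel of the substitution [t]; since [RR] is a domain,
   it is then prime. *)
Definition kernel_of (s : seq RR) (t : 4.-tuple RR) : Prop :=
  forall p, ideal_gen s p <-> p \mPo t = 0.

(** The generators die under [t], which gives one inclusion. Conversely [t] is the identity modulo
    [ideal_gen s], so [p] is congruent to [p \mPo t]. *)
Lemma kernel_ofI s (t : 4.-tuple RR) :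
  (forall g, g \in s -> g \mPo t = 0) ->
  ideal_gen s (x0 - t`_0) -> ideal_gen s (x1 - t`_1) ->
  ideal_gen s (y0 - t`_2) -> ideal_gen s (y1 - t`_3) -> kernel_of s t.
Proof.
move=> st h0 h1 h2 h3 p; split=> [[c ->]|pt0].
  rewrite raddf_sum big1 // => i _.
  rewrite /= rmorphM /= (st (nth 0 s i)) ?mem_nth //; exact: mulr0.
rewrite -[p]subr0 -pt0; apply: alg_endo_congr; first exact: ideal_gen_ideal.
by apply: ord4_ind; rewrite /= comp_mpolyXU.
Qed.

Lemma kernel_cancel s t f g :
  kernel_of s t -> f \mPo t != 0 -> ideal_gen s (f * g) -> ideal_gen s g.
Proof.
move=> st ft /st fg0; apply/st; apply: (mulfI ft).
by rewrite -rmorphM /= fg0 mulr0.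
Qed.

(** * Linear forms in one pair of variables *)

Lemma comp_Hf a (t : 4.-tuple RR) : Hf a \mPo t = a.2 *: t`_0 - a.1 *: t`_1.
Proof. by rewrite comp_mpolyB !comp_mpolyZ !comp_mpolyXU. Qed.

Lemma comp_Vf a (t : 4.-tuple RR) : Vf a \mPo t = a.2 *: t`_2 - a.1 *: t`_3.
Proof. by rewrite comp_mpolyB !comp_mpolyZ !comp_mpolyXU. Qed.

Definition linx (u : CC * CC) : RR := u.1 *: x0 + u.2 *: x1.
Definition liny (u : CC * CC) : RR := u.1 *: y0 + u.2 *: y1.

(** Such a [u] parametrizes the ruling: modulo [Hf a] the pair (x0, x1) equals [linx u] times (a.1,
    a.2). *)
Lemma nzP1_dual a : nzP1 a -> exists u : CC * CC, u.1 * a.1 + u.2 * a.2 = 1.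
Proof.
case/orP=> nz; [exists (a.1^-1, 0) | exists (0, a.2^-1)].
  by rewrite mul0r addr0 mulVf.
by rewrite mul0r add0r mulVf.
Qed.

Lemma linx_neq0 u : u != 0 -> linx u != 0.
Proof.
apply: contraNneq => u0; have ev v : (linx u).@[v] = 0 by rewrite u0 meval0.
have := ev (fun i => (i == 0)%:R); have := ev (fun i => (i == 1)%:R).
rewrite !mevalD !mevalZ !mevalXU /= !mulr0 !mulr1 add0r addr0.
by case: (u) => a b /= -> ->.
Qed.

Lemma liny_neq0 u : u != 0 -> liny u != 0.
Proof.
apply: contraNneq => u0; have ev v : (liny u).@[v] = 0 by rewrite u0 meval0.
have := ev (fun i => (i == 2)%:R); have := ev (fun i => (i == 3)%:R).
rewrite !mevalD !mevalZ !mevalXU /= !mulr0 !mulr1 add0r addr0.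
by case: (u) => a b /= -> ->.
Qed.

Lemma Hf_linx a : Hf a = linx (a.2, - a.1).
Proof. by rewrite /linx /= scaleNr. Qed.

Lemma Vf_liny a : Vf a = liny (a.2, - a.1).
Proof. by rewrite /liny /= scaleNr. Qed.

Lemma dual_neq0 (u a : CC * CC) : u.1 * a.1 + u.2 * a.2 = 1 -> u != 0.
Proof.
move=> ua; apply: contra_eq_neq ua => ->.
by rewrite !mul0r addr0 eq_sym oner_eq0.
Qed.

Lemma Hf_neq0 a : nzP1 a -> Hf a != 0.
Proof.
move=> nza; rewrite Hf_linx linx_neq0 //; apply/negP => /eqP[a2 a1].
by move: nza; rewrite /nzP1 a2 -oppr_eq0 a1 eqxx.
Qed.

Lemma Vf_neq0 a : nzP1 a -> Vf a != 0.
Proof.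
move=> nza; rewrite Vf_liny liny_neq0 //; apply/negP => /eqP[a2 a1].
by move: nza; rewrite /nzP1 a2 -oppr_eq0 a1 eqxx.
Qed.

(** * Primes generated by rulings *)

Lemma idealZ (I : RR -> Prop) c p : is_ideal I -> I p -> I (c *: p).
Proof. by move=> hI Ip; rewrite -mul_mpolyC; apply: idealM. Qed.

Lemma lin_sub_proj1 (F : fieldType) (V : lmodType F) (x y : V) (u a : F * F) :
  u.1 * a.1 + u.2 * a.2 = 1 ->
  x - a.1 *: (u.1 *: x + u.2 *: y) = u.2 *: (a.2 *: x - a.1 *: y).
Proof.
move=> ua; rewrite scalerDr scalerBr !scalerA opprD addrA.
rewrite -{1}[x]scale1r -scalerBl -ua [a.1 * u.2]mulrC [u.1 * _]mulrC.
by rewrite addrAC subrr add0r.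
Qed.

Lemma lin_sub_proj2 (F : fieldType) (V : lmodType F) (x y : V) (u a : F * F) :
  u.1 * a.1 + u.2 * a.2 = 1 ->
  y - a.2 *: (u.1 *: x + u.2 *: y) = (- u.1) *: (a.2 *: x - a.1 *: y).
Proof.
move=> ua; rewrite addrC -[a.2 *: x - _]opprB scalerN scaleNr opprK.
rewrite scalerDr scalerBr !scalerA opprD -addrA [X in _ + X]addrC addrC.
rewrite -{1}[y]scale1r -scalerBl -ua [a.2 * u.2]mulrC [u.1 * a.2]mulrC.
by rewrite addrK.
Qed.

Lemma lin_cramer (F : fieldType) (V : lmodType F) (x y : V) (a c : F * F) :
  a.1 * c.2 != a.2 * c.1 ->
  let d := (a.2 * c.1 - a.1 * c.2)^-1 in
  x = d *: (c.1 *: (a.2 *: x - a.1 *: y) - a.1 *: (c.2 *: x - c.1 *: y)) /\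
  y = d *: (c.2 *: (a.2 *: x - a.1 *: y) - a.2 *: (c.2 *: x - c.1 *: y)).
Proof.
rewrite eq_sym -subr_eq0 => dn0 d; split.
  rewrite [X in d *: X](_ : _ = (a.2 * c.1 - a.1 * c.2) *: x).
    by rewrite scalerA mulVf // scale1r.
  rewrite !scalerBr !scalerA opprB addrA [c.1 * a.1]mulrC subrK -scalerBl.
  by rewrite [c.1 * _]mulrC.
rewrite [X in d *: X](_ : _ = (a.2 * c.1 - a.1 * c.2) *: y).
  by rewrite scalerA mulVf // scale1r.
rewrite !scalerBr !scalerA opprB addrC addrA [c.2 * a.2]mulrC subrK -scalerBl.
by rewrite [c.2 * _]mulrC.
Qed.

Lemma sameP1_sym a b : sameP1 a b = sameP1 b a.
Proof. by rewrite /sameP1 eq_sym [a.2 * _]mulrC [a.1 * _]mulrC. Qed.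

Lemma sameP1_trans a b c : nzP1 b -> sameP1 a b -> sameP1 b c -> sameP1 a c.
Proof.
rewrite /sameP1 => + /eqP ab /eqP bc => /orP[] nzb; apply/eqP/(mulfI nzb).
  by rewrite mulrCA bc mulrA ab -mulrA mulrCA.
by rewrite mulrA [b.2 * a.1]mulrC ab -mulrA bc mulrCA.
Qed.

(** Distinct rulings of one family have independent forms, so Cramer's rule recovers both
    variables. *)
Lemma linx_mem a c s : ~~ sameP1 a c -> Hf a \in s -> Hf c \in s ->
  ideal_gen s x0 /\ ideal_gen s x1.
Proof.
move=> ac /mem_ideal_gen sa /mem_ideal_gen sc; have hI := ideal_gen_ideal s.
have [e0 e1] := lin_cramer x0 x1 ac.
by split; [rewrite e0 | rewrite e1]; exact: (idealZ _ hI (idealB hI (idealZ _ hI sa) (idealZ _ hI sc))).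
Qed.

(** The substitution restricts polynomials to the zero set of [Hf a], with [linx u] as surviving
    coordinate. The next kernels follow the same pattern; two distinct horizontal rulings force x0
    and x1 to 0. *)
Lemma kernel_H a u : u.1 * a.1 + u.2 * a.2 = 1 ->
  kernel_of [:: Hf a] [tuple a.1 *: linx u; a.2 *: linx u; y0; y1].
Proof.
move=> ua; have hI := ideal_gen_ideal [:: Hf a].
have Ha : ideal_gen [:: Hf a] (Hf a) by exact: (mem_ideal_gen (mem_head _ _)).
apply: kernel_ofI => /= [g||||].
- rewrite inE => /eqP ->; rewrite comp_Hf /= !scalerA mulrC; exact: subrr.
- by rewrite /linx lin_sub_proj1 //; exact: (idealZ _ hI Ha).
- by rewrite /linx lin_sub_proj2 //; exact: (idealZ _ hI Ha).
- by rewrite subrr; apply: ideal0.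
- by rewrite subrr; apply: ideal0.
Qed.

Lemma kernel_V b w : w.1 * b.1 + w.2 * b.2 = 1 ->
  kernel_of [:: Vf b] [tuple x0; x1; b.1 *: liny w; b.2 *: liny w].
Proof.
move=> wb; have hI := ideal_gen_ideal [:: Vf b].
have Vb : ideal_gen [:: Vf b] (Vf b) by exact: (mem_ideal_gen (mem_head _ _)).
apply: kernel_ofI => /= [g||||].
- rewrite inE => /eqP ->; rewrite comp_Vf /= !scalerA mulrC; exact: subrr.
- by rewrite subrr; apply: ideal0.
- by rewrite subrr; apply: ideal0.
- by rewrite /liny lin_sub_proj1 //; exact: (idealZ _ hI Vb).
- by rewrite /liny lin_sub_proj2 //; exact: (idealZ _ hI Vb).
Qed.

Lemma kernel_HV a b u w :
  u.1 * a.1 + u.2 * a.2 = 1 -> w.1 * b.1 + w.2 * b.2 = 1 ->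
  kernel_of [:: Hf a; Vf b]
    [tuple a.1 *: linx u; a.2 *: linx u; b.1 *: liny w; b.2 *: liny w].
Proof.
move=> ua wb; set s := [:: _; _]; have hI := ideal_gen_ideal s.
have Ha : ideal_gen s (Hf a) by exact: (mem_ideal_gen (mem_head _ _)).
have Vb : ideal_gen s (Vf b) by exact: (mem_ideal_gen (mem_second _ _ _)).
apply: kernel_ofI => /= [g||||].
- rewrite !inE => /orP[] /eqP ->.
    rewrite comp_Hf /= !scalerA mulrC; exact: subrr.
  rewrite comp_Vf /= !scalerA mulrC; exact: subrr.
- by rewrite /linx lin_sub_proj1 //; exact: (idealZ _ hI Ha).
- by rewrite /linx lin_sub_proj2 //; exact: (idealZ _ hI Ha).
- by rewrite /liny lin_sub_proj1 //; exact: (idealZ _ hI Vb).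
- by rewrite /liny lin_sub_proj2 //; exact: (idealZ _ hI Vb).
Qed.

Lemma kernel_HH a c : ~~ sameP1 a c ->
  kernel_of [:: Hf a; Hf c] [tuple 0; 0; y0; y1].
Proof.
move=> ac; set s := [:: _; _]; have hI := ideal_gen_ideal s.
have [s0 s1] : ideal_gen s x0 /\ ideal_gen s x1.
  by exact: (linx_mem ac (mem_head _ _) (mem_second _ _ _)).
apply: kernel_ofI => /= [g||||]; rewrite ?subr0 ?subrr //.
- by rewrite !inE => /orP[] /eqP ->; rewrite comp_Hf /= !scaler0 subr0.
- exact: ideal0.
- exact: ideal0.
Qed.

Lemma kernel_HHV a c d w : ~~ sameP1 a c -> w.1 * d.1 + w.2 * d.2 = 1 ->
  kernel_of [:: Hf a; Hf c; Vf d] [tuple 0; 0; d.1 *: liny w; d.2 *: liny w].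
Proof.
move=> ac wd; set s := [:: _; _; _]; have hI := ideal_gen_ideal s.
have [s0 s1] : ideal_gen s x0 /\ ideal_gen s x1.
  by exact: (linx_mem ac (mem_head _ _) (mem_second _ _ _)).
have Vd : ideal_gen s (Vf d) by exact: (mem_ideal_gen (mem_third _ _ _ _)).
apply: kernel_ofI => /= [g||||]; rewrite ?subr0 //.
- rewrite !inE => /or3P[] /eqP ->; rewrite ?comp_Hf /= ?scaler0 ?subr0 //.
  rewrite comp_Vf /= !scalerA mulrC; exact: subrr.
- by rewrite /liny lin_sub_proj1 //; exact: (idealZ _ hI Vd).
- by rewrite /liny lin_sub_proj2 //; exact: (idealZ _ hI Vd).
Qed.

Lemma proj_neq0 (F : fieldType) (V : lmodType F) (s : V) (a a' : F * F) :
  a.1 * a'.2 != a.2 * a'.1 -> s != 0 ->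
  a'.2 *: (a.1 *: s) - a'.1 *: (a.2 *: s) != 0.
Proof.
move=> aa' s0; rewrite !scalerA -scalerBl scaler_eq0 negb_or s0 andbT subr_eq0.
by rewrite [a'.2 * _]mulrC [a'.1 * _]mulrC.
Qed.

Lemma linx_dual_neq0 u (a : CC * CC) : u.1 * a.1 + u.2 * a.2 = 1 -> linx u != 0.
Proof. by move/dual_neq0/linx_neq0. Qed.

Lemma liny_dual_neq0 u (a : CC * CC) : u.1 * a.1 + u.2 * a.2 = 1 -> liny u != 0.
Proof. by move/dual_neq0/liny_neq0. Qed.

(** Here and in the next lemmas, the form to be cancelled restricts to a nonzero form on the zero
    set of the generators, hence lies outside their prime ideal. *)
Lemma cancelH_H a a' g : nzP1 a -> ~~ sameP1 a a' ->
  ideal_gen [:: Hf a] (Hf a' * g) -> ideal_gen [:: Hf a] g.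
Proof.
move=> /nzP1_dual[u ua] aa'; apply: (kernel_cancel (kernel_H ua)).
by rewrite comp_Hf proj_neq0 // (linx_dual_neq0 ua).
Qed.

Lemma cancelV_V b b' g : nzP1 b -> ~~ sameP1 b b' ->
  ideal_gen [:: Vf b] (Vf b' * g) -> ideal_gen [:: Vf b] g.
Proof.
move=> /nzP1_dual[w wb] bb'; apply: (kernel_cancel (kernel_V wb)).
by rewrite comp_Vf proj_neq0 // (liny_dual_neq0 wb).
Qed.

Lemma cancelV_H b a g : nzP1 b -> nzP1 a ->
  ideal_gen [:: Vf b] (Hf a * g) -> ideal_gen [:: Vf b] g.
Proof.
move=> /nzP1_dual[w wb] nza; apply: (kernel_cancel (kernel_V wb)).
by rewrite comp_Hf; exact: Hf_neq0.
Qed.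

Lemma cancelHV_H a b a' g : nzP1 a -> nzP1 b -> ~~ sameP1 a a' ->
  ideal_gen [:: Hf a; Vf b] (Hf a' * g) -> ideal_gen [:: Hf a; Vf b] g.
Proof.
move=> /nzP1_dual[u ua] /nzP1_dual[w wb] aa'.
apply: (kernel_cancel (kernel_HV ua wb)).
by rewrite comp_Hf proj_neq0 // (linx_dual_neq0 ua).
Qed.

Lemma cancelHV_V a b b' g : nzP1 a -> nzP1 b -> ~~ sameP1 b b' ->
  ideal_gen [:: Hf a; Vf b] (Vf b' * g) -> ideal_gen [:: Hf a; Vf b] g.
Proof.
move=> /nzP1_dual[u ua] /nzP1_dual[w wb] bb'.
apply: (kernel_cancel (kernel_HV ua wb)).
by rewrite comp_Vf proj_neq0 // (liny_dual_neq0 wb).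
Qed.

Lemma cancelHH_V a c b g : ~~ sameP1 a c -> nzP1 b ->
  ideal_gen [:: Hf a; Hf c] (Vf b * g) -> ideal_gen [:: Hf a; Hf c] g.
Proof.
move=> ac nzb; apply: (kernel_cancel (kernel_HH ac)).
by rewrite comp_Vf; exact: Vf_neq0.
Qed.

Lemma cancelHHV_V a c d b g : ~~ sameP1 a c -> nzP1 d -> ~~ sameP1 d b ->
  ideal_gen [:: Hf a; Hf c; Vf d] (Vf b * g) ->
  ideal_gen [:: Hf a; Hf c; Vf d] g.
Proof.
move=> ac /nzP1_dual[w wd] db; apply: (kernel_cancel (kernel_HHV ac wd)).
by rewrite comp_Vf proj_neq0 // (liny_dual_neq0 wd).
Qed.

(** * Lists of pairwise distinct rulings *)

Definition distinctP1 (s : seq P1pt) : bool :=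
  all nzP1 s && pairwise (fun a b => ~~ sameP1 a b) s.

Lemma distinctP1_cons a s : distinctP1 (a :: s) =
  [&& nzP1 a, all (fun b => ~~ sameP1 a b) s & distinctP1 s].
Proof. by rewrite /distinctP1 /=; case: (nzP1 a) => //=; rewrite andbCA. Qed.

Lemma distinctP1_cat s1 s2 : distinctP1 (s1 ++ s2) =
  [&& allrel (fun a b => ~~ sameP1 a b) s1 s2, distinctP1 s1 & distinctP1 s2].
Proof.
rewrite /distinctP1 all_cat pairwise_cat.
by do 2!case: (all nzP1 _) => //=; rewrite ?andbF ?andbT.
Qed.

Lemma distinctP1_nth s i j : distinctP1 s -> (i < size s)%N -> (j < size s)%N ->
  i != j -> ~~ sameP1 (nth P1zero s i) (nth P1zero s j).
Proof.
case/andP=> _ /(pairwiseP P1zero) pws lti ltj.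
by rewrite neq_ltn => /orP[ij|ji]; [|rewrite sameP1_sym]; apply: pws.
Qed.

Lemma distinctP1_nz s i : distinctP1 s -> (i < size s)%N -> nzP1 (nth P1zero s i).
Proof. by case/andP=> /all_nthP nzs _ /nzs. Qed.

(** After one [Vf b] is split off modulo [Hf a], the cofactor still satisfies the remaining
    conditions, because [Vf b] cancels there. *)
Lemma ruling_cap a (s : seq P1pt) p : nzP1 a -> distinctP1 s ->
  (forall b, b \in s -> ideal_gen [:: Hf a; Vf b] p) ->
  exists q k, p = (\prod_(b <- s) Vf b) * q + Hf a * k.
Proof.
move=> nza; elim: s p => [|b s IH] p.
  by exists p, 0; rewrite big_nil; ring.
rewrite distinctP1_cons => /and3P[nzb /allP bs ds] ps.
have /ps /ideal_gen2 [k [q pE]] : b \in b :: s by rewrite inE eqxx.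
have [|q' [k' qE]] := IH q ds.
  move=> b' b's; have /andP[/allP nzs _] := ds.
  apply: (cancelHV_V nza (nzs _ b's) (b' := b)).
    by rewrite sameP1_sym; apply: bs.
  rewrite (_ : _ * _ = p - k * Hf a); last by rewrite pE; ring.
  have hI := ideal_gen_ideal [:: Hf a; Vf b'].
  refine (idealB hI (ps _ _) (idealM _ hI (mem_ideal_gen _))).
    by rewrite inE b's orbT.
  by rewrite inE eqxx.
exists q', (k + k' * Vf b); rewrite big_cons pE qE.
move: (\prod_(_ <- _) _) (Vf b) (Hf a) => ? ? ?; ring.
Qed.

(** * Staircase ideals *)

(* The polarized staircase ideal generated by the
   [H_0 ... H_(i-1) V_0 ... V_(lam i - 1)], with [lam (size As) := 0]. *)
Fixpoint stair (Bs As : seq P1pt) (lam : nat -> nat) (p : RR) : Prop :=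
  if As is a :: As' then
    exists q k, p = prodV Bs (lam 0%N) * q + Hf a * k /\
                stair Bs As' (lam \o succn) k
  else True.

Lemma stair_ideal Bs As lam : is_ideal (stair Bs As lam).
Proof.
elim: As lam => [|a As IH] lam; first by split; [|split].
have hI := IH (lam \o succn); split; [|split].
- by exists 0, 0; split; [ring | exact: ideal0].
- move=> _ _ [q [k [-> kI]]] [q' [k' [-> k'I]]]; exists (q + q'), (k + k').
  by split; [ring | exact: idealD].
- move=> r _ [q [k [-> kI]]]; exists (r * q), (r * k).
  by split; [ring | exact: idealM].
Qed.

Lemma prodV_vanish_pt Bs k b a : b \in take k Bs ->
  ideal_gen [:: Hf a; Vf b] (prodV Bs k).
Proof.
rewrite /prodV => bs; rewrite (big_rem _ bs) /=.
have hI := ideal_gen_ideal [:: Hf a; Vf b]; refine (ideal_mulr _ hI _).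
exact: (mem_ideal_gen (mem_second _ _ _)).
Qed.

(** By [ruling_cap] the conditions on the first ruling mean p = P q + H_a k with P =
    [prodV Bs (lam 0)]. As [lam] is nonincreasing, P vanishes at the points of all later rulings,
    and there H_a cancels, so the other conditions concern [k] alone. *)
Lemma stairP Bs As lam p : distinctP1 As -> distinctP1 Bs ->
  (forall i j, i <= j -> lam j <= lam i)%N ->
  stair Bs As lam p <->
  (forall i, i < size As -> forall b, b \in take (lam i) Bs ->
    ideal_gen [:: Hf (nth P1zero As i); Vf b] p)%N.
Proof.
elim: As lam p => [|a As IH] lam p //; rewrite distinctP1_cons.
move=> /and3P[nza /allP aAs dAs] dBs lamP.
have lam'P i j : (i <= j -> (lam \o succn) j <= (lam \o succn) i)%N.
  by move=> ij; apply: lamP.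
have sub i b : b \in take (lam i) Bs -> b \in take (lam 0%N) Bs.
  rewrite -(subnKC (lamP 0%N i (leq0n i))) takeD => bs.
  by rewrite mem_cat bs.
split=> [[q [k [-> kI]]]|pI].
  case=> [|i] lti b bs; have hI := ideal_gen_ideal [:: Hf (nth P1zero (a :: As) 0); Vf b].
    refine (idealD hI (ideal_mulr _ hI (prodV_vanish_pt _ bs)) (ideal_mulr _ hI _)).
    by apply: mem_ideal_gen; rewrite inE eqxx.
  have hI' := ideal_gen_ideal [:: Hf (nth P1zero (a :: As) i.+1); Vf b].
  refine (idealD hI' (ideal_mulr _ hI' (prodV_vanish_pt _ (sub _ _ bs))) (idealM _ hI' _)).
  by move/(IH _ _ dAs dBs lam'P): kI; apply.
have nzBs i b : b \in take (lam i) Bs -> nzP1 b.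
  by move/mem_take; case/andP: dBs => /allP h _ /h.
have dt : distinctP1 (take (lam 0%N) Bs).
  by move: dBs; rewrite -{1}[Bs](cat_take_drop (lam 0%N)) distinctP1_cat => /and3P[].
have [q [k pE]] := ruling_cap nza dt (pI 0%N isT).
exists q, k; split=> //; apply/(IH _ _ dAs dBs lam'P) => i lti b bs.
apply: (cancelHV_H _ (nzBs _ _ bs) (a' := a)).
- exact: distinctP1_nz.
- by rewrite sameP1_sym; apply/aAs/mem_nth.
rewrite (_ : _ * _ = p - prodV Bs (lam 0%N) * q); last by rewrite pE /prodV; ring.
have hI := ideal_gen_ideal [:: Hf (nth P1zero As i); Vf b].
refine (idealB hI (pI i.+1 lti b bs) (ideal_mulr _ hI (prodV_vanish_pt _ (sub _ _ bs)))).
Qed.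

Lemma cancel_prod (F : P1pt -> RR) (I : RR -> Prop) (s : seq P1pt) g :
  (forall b h, b \in s -> I (F b * h) -> I h) ->
  I ((\prod_(b <- s) F b) * g) -> I g.
Proof.
elim: s g => [|b s IH] g Is; first by rewrite big_nil mul1r.
rewrite big_cons -mulrA => /Is; rewrite inE eqxx => /(_ isT).
by apply: IH => b' h b's; apply: Is; rewrite inE b's orbT.
Qed.

Lemma ideal_add1 I g p :
  ideal_add I [:: g] p <-> exists e k, p = e + k * g /\ I e.
Proof.
split=> [[e [Ie /ideal_gen1 [k ek]]]|[e [k [-> Ie]]]].
  by exists e, k; split; [rewrite -ek addrC subrK | exact: Ie].
exists e; split; first exact: Ie.
by apply/ideal_gen1; exists k; rewrite addrAC subrr add0r.
Qed.

Lemma stair_prodV Bs As lam k q :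
  (lam 0 <= k)%N -> stair Bs As lam (prodV Bs k * q).
Proof.
case: As => [|a As] //= lk.
exists ((\prod_(b <- take (k - lam 0) (drop (lam 0) Bs)) Vf b) * q), 0.
split; last exact: (ideal0 (stair_ideal _ _ _)).
by rewrite mulr0 addr0 /prodV -{1}(subnKC lk) takeD big_cat /= mulrA.
Qed.

(* Modulo [(H_a, H_c)], where [H_a] is the first ruling, one can divide by
   [V_d]; dividing the remainder by [H_a] leads to the shorter staircase. *)
Lemma stair_regular c d As Bs lam g :
  nzP1 c -> nzP1 d -> (forall a, a \in As -> ~~ sameP1 a c) ->
  (forall b, b \in Bs -> ~~ sameP1 b d) ->
  (forall i j, i <= j -> lam j <= lam i)%N ->
  ideal_add (stair Bs As lam) [:: Hf c] (Vf d * g) ->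
  ideal_add (stair Bs As lam) [:: Hf c] g.
Proof.
move=> nzc nzd + Bsd; elim: As lam g => [|a As IH] lam g Asc lamP.
  by move=> _; apply/ideal_add1; exists g, 0; split; [ring|].
have ac : ~~ sameP1 a c by apply: Asc; rewrite inE eqxx.
case/ideal_add1=> e' [k [gE [r [e [e'E eI]]]]]; rewrite {}e'E in gE.
pose P := prodV Bs (lam 0%N).
(* From V_d g = P r + H_a e + k H_c, the product P r lies in (H_a, H_c, V_d). The factors of P
   cancel there, so r = r1 H_a + k' H_c + r' V_d. *)
have /ideal_gen_cons [r1 [r2 [rE /ideal_gen2 [k' [r' r2E]]]]] :
    ideal_gen [:: Hf a; Hf c; Vf d] r.
  apply: (@cancel_prod Vf _ (take (lam 0%N) Bs)).
    move=> b h /mem_take bs; apply: cancelHHV_V => //.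
    by rewrite sameP1_sym; apply: Bsd.
  apply/ideal_gen_cons; exists (- e), (- k * Hf c + g * Vf d); split.
    rewrite -/(prodV _ _) [g * _]mulrC gE -/P; clear; move: P (Hf a) (Hf c) => *; ring.
  by apply/ideal_gen2; exact: (ex_intro _ (- k) (ex_intro _ g erefl)).
(* After substitution, V_d (g - P r') = (e + P r1) H_a + (k + P k') H_c, and V_d cancels. *)
have /ideal_gen2 [g2 [m g2E]] : ideal_gen [:: Hf a; Hf c] (g - P * r').
  apply: (@cancelHH_V a c d) => //.
  apply/ideal_gen2; exists (e + P * r1), (k + P * k').
  rewrite mulrBr gE rE r2E -/P; clear; move: P (Hf a) (Hf c) (Vf d) => *; ring.
(* With g - P r' = g2 H_a + m H_c, comparison shows that H_a (V_d g2 - e - P r1) is a multiple of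
   H_c, and H_a cancels. *)
have /ideal_gen1 [n nE] : ideal_gen [:: Hf c] (Vf d * g2 - e - P * r1).
  apply: (@cancelH_H c a) => //; first by rewrite sameP1_sym.
  apply/ideal_gen1; exists (k + P * k' - Vf d * m).
  have : Vf d * (g - P * r') = Vf d * (g2 * Hf a + m * Hf c) by rewrite g2E.
  rewrite mulrBr gE rE r2E -/P => H.
  rewrite (_ : Hf a * _ = Vf d * (g2 * Hf a + m * Hf c) - Vf d * m * Hf c
                          - Hf a * e - P * r1 * Hf a); last first.
    by clear; move: P (Hf a) (Hf c) (Vf d) => *; ring.
  rewrite -H; clear; move: P (Hf a) (Hf c) (Vf d) => *; ring.
(* Since [lam] is nonincreasing, P r1 lies with [e] in the ideal of the shorter staircase, so
   induction applies to [g2]. *)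
have /IH /ideal_add1 [||e2 [k2 [g2E' e2I]]] :
    ideal_add (stair Bs As (lam \o succn)) [:: Hf c] (Vf d * g2).
- apply/ideal_add1; exists (e + P * r1), n; split.
    by rewrite -nE; clear; move: P (Vf d) => *; ring.
  have PI : stair Bs As (lam \o succn) (P * r1) by apply/stair_prodV/lamP.
  exact: (idealD (stair_ideal _ _ _) eI PI).
- by move=> b bs; apply: Asc; rewrite inE bs orbT.
- by move=> i j ij; apply: lamP.
apply/ideal_add1; exists (P * r' + Hf a * e2), (k2 * Hf a + m); split.
  rewrite -[g](subrK (P * r')) g2E g2E'.
  clear; move: P (Hf a) (Hf c) => *; ring.
by exists r', e2.
Qed.

(** * Dimension and depth at most two *)

Lemma dependent_family (F : fieldType) (E C : finType) (v : E -> C -> F) :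
  (#|C| < #|E|)%N ->
  exists gam : E -> F,
    (exists e, gam e != 0) /\ forall c, \sum_e gam e * v e c = 0.
Proof.
move=> ltCE; pose A := \matrix_(i < #|E|, j < #|C|) v (enum_val i) (enum_val j).
have : kermx A != 0.
  rewrite kermx_eq0 -row_leq_rank -ltnNge.
  exact: leq_ltn_trans (rank_leq_col A) ltCE.
case/rowV0Pn=> u /sub_kermxP uA u0.
exists (fun e => u ord0 (enum_rank e)); split.
  have [i ui] : exists i, u ord0 i != 0.
    apply/existsP; apply: contraR u0 => /existsPn u0.
    by apply/eqP/rowP => i; have := u0 i; rewrite negbK mxE => /eqP.
  by exists (enum_val i); rewrite enum_valK.
move=> c; have /matrixP/(_ ord0 (enum_rank c)) := uA; rewrite !mxE => uAc.
rewrite -[RHS]uAc (reindex (@enum_val E E)) /=; last exact/onW_bij/enum_val_bij.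
by apply: eq_bigr => i _; rewrite mxE enum_valK enum_rankK.
Qed.

(** For the least [i] in [z], every other nonzero term carries a power of [a] above [i]; one factor
    [a] of the excess stays outside [c]. *)
Lemma lowest_term (R : comNzRingType) n (a : R) (g : 'I_n -> R) (z : pred 'I_n) :
  (forall i, ~~ z i -> g i = 0) -> (exists i, z i) ->
  exists (i : 'I_n) c, z i /\ \sum_(i < n) a ^+ i * g i = a ^+ i * (g i + c * a).
Proof.
move=> gz [i0 zi0]; case: (arg_minnP (@nat_of_ord n) zi0) => i zi imin.
exists i, (\sum_(k < n | k != i) g k * a ^+ (k - i).-1); split=> //.
rewrite (bigD1 i) //= mulrDr; congr (_ + _).
rewrite mulr_suml mulr_sumr; apply: eq_bigr => k ki.
have [zk|/gz ->] := boolP (z k); last by rewrite mulr0 !mul0r mulr0.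
have ltik : (i < k)%N by rewrite ltn_neqAle eq_sym ki imin.
rewrite -mulrA -exprSr prednK ?subn_gt0 // mulrCA -exprD subnKC ?(ltnW ltik) //.
by rewrite mulrC.
Qed.

(** Restriction to the cone over [P], whose points are (s P.1, t P.2). The two parameters are the
    source of the bound two. *)
Definition bigrade (P : P1P1pt) : 4.-tuple {mpoly CC[2]} :=
  [tuple P.1.1 *: 'X_0; P.1.2 *: 'X_0; P.2.1 *: 'X_1; P.2.2 *: 'X_1].

(** Substituting [linx u] and [liny w] for the parameters turns the restriction into an endomorphism
    of [RR] that is the identity modulo [I_pt P]. *)
Lemma bigrade_kernel P p : nzP1 P.1 -> nzP1 P.2 ->
  p \mPo bigrade P = 0 -> I_pt P p.
Proof.
move=> /nzP1_dual[u ua] /nzP1_dual[w wb] p0.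
pose lift (q : {mpoly CC[2]}) : RR := q \mPo [tuple linx u; liny w].
have hI := ideal_gen_ideal [:: Hf P.1; Vf P.2].
have Ha : ideal_gen [:: Hf P.1; Vf P.2] (Hf P.1).
  by exact: (mem_ideal_gen (mem_head _ _)).
have Vb : ideal_gen [:: Hf P.1; Vf P.2] (Vf P.2).
  by exact: (mem_ideal_gen (mem_second _ _ _)).
have := @alg_endo_congr (lift \o comp_mpoly (bigrade P)) _ hI _ p.
rewrite /= p0 /lift comp_mpoly0 subr0; apply.
apply: ord4_ind; rewrite comp_mpolyXU /= comp_mpolyZ comp_mpolyXU /=.
- by rewrite /linx lin_sub_proj1 //; exact: (idealZ _ hI Ha).
- by rewrite /linx lin_sub_proj2 //; exact: (idealZ _ hI Ha).
- by rewrite /liny lin_sub_proj1 //; exact: (idealZ _ hI Vb).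
- by rewrite /liny lin_sub_proj2 //; exact: (idealZ _ hI Vb).
Qed.

Definition mnm2 (i j : nat) : 'X_{1.. 2} := [multinom [tuple i; j]].

Lemma mpoly2_eq0 (q : {mpoly CC[2]}) D : (msize q <= D)%N ->
  (forall i j : 'I_D, q@_(mnm2 i j) = 0) -> q = 0.
Proof.
move=> qD q0; apply/mpolyP => m; rewrite mcoeff0.
have [Dm|mD] := leqP D (mdeg m).
  by rewrite memN_msupp_eq0 // msize_mdeg_ge // (leq_trans qD).
have mE : mdeg m = (m ord0 + m ord_max)%N.
  by rewrite mdegE !big_ord_recl big_ord0 addn0; congr (_ + m _)%N; apply: val_inj.
have m0 : (m ord0 < D)%N by rewrite (leq_ltn_trans _ mD) // mE leq_addr.
have m1 : (m ord_max < D)%N by rewrite (leq_ltn_trans _ mD) // mE leq_addl.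
have := q0 (Ordinal m0) (Ordinal m1); rewrite (_ : mnm2 _ _ = m) //.
apply/mnmP => i; rewrite multinomE (tnth_nth 0%N) /=.
by case: i => [[|[|//]] lti] /=; congr (m _); apply: val_inj.
Qed.

Lemma msizeX_le n (p : {mpoly CC[n]}) k d :
  (msize p <= d)%N -> (msize (p ^+ k) <= (k * d.+1).+1)%N.
Proof.
move=> pd; elim: k => [|k IH]; first by rewrite expr0 msize1.
rewrite exprS (leq_trans (msizeM_le _ _)) // ltnS mulSn.
by rewrite (leq_trans (leq_add pd IH)) // addnS addSn.
Qed.

(** [A], [B], [C] stand for the sizes of three powers, [BC] and [ABC] for those of their products;
    each of the five bounds adds 1 to the constant 5. *)
Lemma degree_bound n d i j k (A B C BC ABC : nat) :
  (i < n -> j < n -> k < n ->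
   A <= (i * d.+1).+1 -> B <= (j * d.+1).+1 -> C <= (k * d.+1).+1 ->
   ABC <= (A + BC).+1 -> BC <= (B + C).+1 -> ABC <= 3 * n * d.+1 + 5)%N.
Proof.
move=> /ltnW hi /ltnW hj /ltnW hk.
have := leq_mul hi (leqnn d.+1); have := leq_mul hj (leqnn d.+1).
have := leq_mul hk (leqnn d.+1); rewrite -mulnA.
move: (i * _)%N (j * _)%N (k * _)%N (n * _)%N => *; lia.
Qed.

(** A count of linear conditions: there are n^3 monomials in [a], [b], [c], while their restrictions
    to the cones have |X| D^2 coefficients with D linear in n. For large n some nontrivial
    combination vanishes on every cone. *)
Lemma I_X_dependence X (a b c : RR) :
  (forall P, P \in X -> nzP1 P.1 && nzP1 P.2) ->
  exists n (gam : 'I_n * 'I_n * 'I_n -> CC), (exists e, gam e != 0) /\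
    I_X X (\sum_e gam e *: (a ^+ e.1.1 * (b ^+ e.1.2 * c ^+ e.2))).
Proof.
move=> nzX.
pose deg (p : RR) := (\sum_(P <- X) msize (p \mPo bigrade P))%N.
have degP p P : P \in X -> (msize (p \mPo bigrade P) <= deg p)%N.
  by move=> PX; rewrite /deg (big_rem P) //= leq_addr.
pose d := (deg a + deg b + deg c)%N.
(* Then D <= n (3 d + 8), so |X| D^2 <= n^2 |X| (3 d + 8)^2 < n^3. *)
pose n := (size X * (3 * d + 8) ^ 2).+1; pose D := (3 * n * d.+1 + 5)%N.
pose mon (e : 'I_n * 'I_n * 'I_n) : RR := a ^+ e.1.1 * (b ^+ e.1.2 * c ^+ e.2).
have monP e P : P \in X -> (msize (mon e \mPo bigrade P) <= D)%N.
  move=> PX; rewrite /mon !rmorphM !rmorphXn /=.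
  have ha := @msizeX_le _ (a \mPo bigrade P) e.1.1 d (leq_trans (degP a P PX) _).
  have hb := @msizeX_le _ (b \mPo bigrade P) e.1.2 d (leq_trans (degP b P PX) _).
  have hc := @msizeX_le _ (c \mPo bigrade P) e.2 d (leq_trans (degP c P PX) _).
  have {}ha := ha ltac:(rewrite /d; lia).
  have {}hb := hb ltac:(rewrite /d; lia).
  have {}hc := hc ltac:(rewrite /d; lia).
  exact: degree_bound (ltn_ord _) (ltn_ord _) (ltn_ord _) ha hb hc
    (msizeM_le _ _) (msizeM_le _ _).
pose v e (x : 'I_(size X) * 'I_D * 'I_D) : CC :=
  (mon e \mPo bigrade (nth (P1zero, P1zero) X x.1.1))@_(mnm2 x.1.2 x.2).
have [|gam [gam0 gamv]] := dependent_family v.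
  rewrite !card_prod !card_ord /D.
  have DN : (3 * n * d.+1 + 5 <= n * (3 * d + 8))%N by rewrite /n; nia.
  apply: (@leq_ltn_trans (size X * ((n * (3 * d + 8)) * (n * (3 * d + 8))))%N).
    by rewrite -mulnA leq_mul2l leq_mul ?orbT.
  rewrite (_ : _ * _ = n * n * (size X * (3 * d + 8) ^ 2))%N; last by lia.
  by rewrite ltn_pmul2l // ltnS.
exists n, gam; split=> // P PX.
have /andP[nz1 nz2] := nzX P PX; apply: bigrade_kernel => //.
apply: (@mpoly2_eq0 _ D) => [|i j].
  rewrite raddf_sum (leq_trans (msize_sum _ _ _)) //.
  apply/bigmax_leqP => e _; rewrite /= comp_mpolyZ.
  exact: leq_trans (msizeZ_le _ _) (monP e P PX).
have ltP : (index P X < size X)%N by rewrite index_mem.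
rewrite -[RHS](gamv (Ordinal ltP, i, j)) (raddf_sum (comp_mpoly (bigrade P))) raddf_sum /=.
by apply: eq_bigr => e _; rewrite comp_mpolyZ mcoeffZ /v /= nth_index.
Qed.

(* The Coquand-Lombardi form of [dim (R / I_X) <= 2]: isolate the
   lexicographically lowest monomial of an algebraic relation. *)
Lemma I_X_relation X (a b c : RR) :
  (forall P, P \in X -> nzP1 P.1 && nzP1 P.2) ->
  exists i j k (u v w : RR), I_X X
    (a ^+ i * (b ^+ j * (c ^+ k * (1 + u * c) + v * b) + w * a)).
Proof.
move=> nzX; have [n [gam [[[[i0 j0] k0] gam0] rel]]] := I_X_dependence a b c nzX.
(* The relation is read as a polynomial in [a] over polynomials in [b] over polynomials in [c]; [z1]
   and [z2] mark the exponents under which some scalar is nonzero. *)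
pose g3 i j k : RR := (gam (i, j, k))%:MP.
pose g2 i j := \sum_k c ^+ (k : 'I_n) * g3 i j k.
pose g1 i := \sum_j b ^+ (j : 'I_n) * g2 i j.
pose z2 i j := [exists k, gam (i, j, k) != 0].
pose z1 i := [exists j, z2 i j].
have g3z i j k : ~~ (gam (i, j, k) != 0) -> g3 i j k = 0.
  by rewrite negbK /g3 => /eqP ->; rewrite mpolyC0.
have g2z i j : ~~ z2 i j -> g2 i j = 0.
  move=> /existsPn z; rewrite /g2 big1 // => k _; rewrite g3z ?mulr0 //; exact: z.
have g1z i : ~~ z1 i -> g1 i = 0.
  move=> /existsPn z; rewrite /g1 big1 // => j _; rewrite g2z ?mulr0 //; exact: z.
have [|i [w [zi eq1]]] := @lowest_term _ n a g1 z1 g1z.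
  by exists i0; apply/existsP; exists j0; apply/existsP; exists k0.
have [|j [v [zj eq2]]] := @lowest_term _ n b (g2 i) (z2 i) (g2z i).
  exact/existsP.
have [|k [u [zk eq3]]] := @lowest_term _ n c (g3 i j) _ (g3z i j).
  exact/existsP.
have relE : \sum_e gam e *: (a ^+ e.1.1 * (b ^+ e.1.2 * c ^+ e.2)) =
    \sum_i a ^+ (i : 'I_n) * g1 i.
  under [RHS]eq_bigr => i' _ do rewrite /g1 mulr_sumr.
  rewrite pair_bigA /=.
  under [RHS]eq_bigr => ij _ do rewrite /g2 !mulr_sumr.
  rewrite pair_bigA /=; apply: eq_bigr => -[[i' j'] k'] _ /=.
  by rewrite /g3 -mul_mpolyC; ring.
(* Multiplying by the inverse of the lowest scalar, nonzero by [zk], makes the constant 1. *)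
exists i, j, k; set h : RR := (gam (i, j, k))^-1%:MP.
exists (h * u), (h * v), (h * w).
have hg : h * g3 i j k = 1 by rewrite /h /g3 -mpolyCM mulVf.
rewrite (_ : _ * _ = h * \sum_i a ^+ (i : 'I_n) * g1 i).
  by rewrite -relE; exact: (idealM _ (I_X_ideal X) rel).
rewrite eq1 {1}/g1 eq2 {1}/g2 eq3 -hg.
by clear; move: (g3 i j k) => ?; ring.
Qed.

Lemma cancel_exp (I : RR -> Prop) a n g :
  (forall h, I (a * h) -> I h) -> I (a ^+ n * g) -> I g.
Proof.
by move=> Ia; elim: n => [|n IH]; rewrite ?mul1r // exprS -mulrA => /Ia /IH.
Qed.

(* Applies both to chains of primes and to the ideals [I + (f_0, ..., f_(k-1))]
   of a regular sequence. *)
Lemma relation_chain (Q : nat -> RR -> Prop) (a : nat -> RR) X :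
  (forall P, P \in X -> nzP1 P.1 && nzP1 P.2) ->
  (forall p, I_X X p -> Q 0 p) ->
  (forall k, (k <= 3)%N -> is_ideal (Q k)) ->
  (forall k, (k < 3)%N -> [/\ forall p, Q k p -> Q k.+1 p, Q k.+1 (a k) &
     forall g, Q k (a k * g) -> Q k g]) ->
  Q 3 1.
Proof.
move=> nzX Q0 hQ Qa.
have [i [j [k [u [v [w rel]]]]]] := I_X_relation (a 0) (a 1) (a 2) nzX.
have [s0 m0 c0] := Qa 0 isT; have [s1 m1 c1] := Qa 1 isT.
have [s2 m2 c2] := Qa 2 isT.
have h1 := hQ 1%N isT; have h2 := hQ 2%N isT; have h3 := hQ 3%N isT.
(* In each round a power of the current element cancels, and in the next ideal the summand divisible
   by that element drops out; after three rounds only 1 is left. *)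
move: rel => /Q0 /(cancel_exp c0) /s0 r0.
have {r0} := idealB h1 r0 (idealM w h1 m0).
rewrite addrK => /(cancel_exp c1) /s1 r1.
have {r1} := idealB h2 r1 (idealM v h2 m1).
rewrite addrK => /(cancel_exp c2) /s2 r2.
by have := idealB h3 r2 (idealM u h3 m2); rewrite addrK.
Qed.

(** * Staircases are arithmetically Cohen-Macaulay *)

Lemma fresh_scalar (s : seq CC) : exists z, z \notin s.
Proof.
case: s => [|a s]; first by exists 0.
pose p : {poly CC} := \prod_(c <- a :: s) ('X - c%:P).
have sp : size p = (size s).+2 by rewrite /p size_prod_XsubC.
(* On the list [p + 1] takes the value 1, so its roots avoid the list. *)
have /closed_rootP[z] : size (p + 1) != 1%N.
  by rewrite size_polyDl ?size_poly1 sp.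
rewrite /root hornerD hornerC => pz; exists z; apply: contraL pz => zs.
have /rootP -> : root p z by rewrite root_prod_XsubC.
by rewrite add0r oner_neq0.
Qed.

Lemma fresh_P1 (s : seq P1pt) :
  exists2 c, nzP1 c & forall a, a \in s -> nzP1 a -> ~~ sameP1 a c.
Proof.
(* A point with [a.1 = 0] contributes the default ratio 0; it differs from every [(1, z)] anyway. *)
have [z zs] := fresh_scalar [seq a.2 / a.1 | a <- s].
exists (1, z) => [|a a_s]; first by rewrite /nzP1 oner_neq0.
rewrite /nzP1 /sameP1 /= mulr1; have [-> /= a2|a1 _] := eqVneq a.1 0.
  by rewrite mul0r eq_sym.
apply: contraNneq zs => azE; apply/mapP; exists a => //.
by rewrite -azE mulrC mulKf.
Qed.

Lemma kernel_prime s t : kernel_of s t -> prime_ideal (ideal_gen s).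
Proof.
move=> st; split; [exact: ideal_gen_ideal | split].
  by move/st/eqP; rewrite rmorph1 oner_eq0.
move=> p q /st; rewrite rmorphM /= => /eqP; rewrite mulf_eq0.
by case/orP=> /eqP h; [left | right]; apply/st.
Qed.

(** The irrelevant maximal ideal, given by evaluation at the origin so that primality is that of a
    kernel. *)
Definition vanish0 (p : RR) : Prop := p.@[fun=> 0] = 0.

Lemma vanish0_ideal : is_ideal vanish0.
Proof.
split; [exact: meval0 | split] => [p q|r p]; rewrite /vanish0.
  by rewrite mevalD => -> ->; rewrite addr0.
by rewrite mevalM => ->; rewrite mulr0.
Qed.

Lemma vanish0_prime : prime_ideal vanish0.
Proof.
split; [exact: vanish0_ideal | split; rewrite /vanish0].
  by rewrite rmorph1 => /eqP; rewrite oner_eq0.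
move=> p q /eqP; rewrite mevalM mulf_eq0.
by case/orP=> /eqP; [left | right].
Qed.

Lemma vanish0_Hf a : vanish0 (Hf a).
Proof. by rewrite /vanish0 mevalB !mevalZ !mevalXU !mulr0 subrr. Qed.

Lemma vanish0_Vf a : vanish0 (Vf a).
Proof. by rewrite /vanish0 mevalB !mevalZ !mevalXU !mulr0 subrr. Qed.

Lemma vanish0_pt P p : I_pt P p -> vanish0 p.
Proof.
apply: ideal_gen_sub vanish0_ideal _ _ => g.
by rewrite !inE => /orP[] /eqP ->; [exact: vanish0_Hf | exact: vanish0_Vf].
Qed.

Lemma irrelevant_var p : p \in [:: x0; x1; y0; y1] -> irrelevant p.
Proof. exact: mem_ideal_gen. Qed.

Lemma irrelevant_Hf a : irrelevant (Hf a).
Proof.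
have hI := ideal_gen_ideal [:: x0; x1; y0; y1].
apply: (idealB hI (idealZ _ hI (irrelevant_var _)) (idealZ _ hI (irrelevant_var _))).
  exact: mem_head.
exact: mem_second.
Qed.

Lemma irrelevant_Vf a : irrelevant (Vf a).
Proof.
have hI := ideal_gen_ideal [:: x0; x1; y0; y1].
apply: (idealB hI (idealZ _ hI (irrelevant_var _)) (idealZ _ hI (irrelevant_var _))).
  exact: mem_third.
by rewrite 3!in_cons mem_seq1 eqxx !orbT.
Qed.

Lemma ideal_add_nil I p : ideal_add I [::] p <-> I p.
Proof.
split=> [[q [Iq /ideal_gen_nil /eqP]]|Ip]; first by rewrite subr_eq0 => /eqP ->.
by exists p; split; [|apply/ideal_gen_nil; rewrite subrr].
Qed.

Lemma ideal_gen_incl s s' p :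
  {subset s <= s'} -> ideal_gen s p -> ideal_gen s' p.
Proof.
move=> ss'; apply: ideal_gen_sub (ideal_gen_ideal s') _ _ => g /ss'.
exact: mem_ideal_gen.
Qed.

(** Elements of each prime outside the preceding one cancel in the preceding one by primality, so
    [relation_chain] would put 1 in the fourth prime. *)
Lemma dim_le2 X n Q : (forall P, P \in X -> nzP1 P.1 && nzP1 P.2) ->
  prime_chain (I_X X) n Q -> (n <= 2)%N.
Proof.
move=> nzX [prQ stQ]; rewrite leqNgt; apply/negP => n3.
have ltn k : (k < 3)%N -> (k < n)%N by move=> k3; apply: leq_trans n3.
have [a0 [a01 a00]] := (stQ 0%N (ltn 0%N isT)).2.
have [a1 [a12 a11]] := (stQ 1%N (ltn 1%N isT)).2.
have [a2 [a23 a22]] := (stQ 2%N (ltn 2%N isT)).2.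
have [[_ [Q31 _]] _] := prQ 3%N n3; apply: Q31.
apply: (@relation_chain Q (nth 0 [:: a0; a1; a2]) X nzX).
- exact: (prQ 0%N (leq0n n)).2.
- by move=> k k3; have [[]] := prQ k (leq_trans k3 n3).
have step k a : (k < 3)%N -> Q k.+1 a -> ~ Q k a ->
    [/\ forall p, Q k p -> Q k.+1 p, Q k.+1 a & forall g, Q k (a * g) -> Q k g].
  move=> k3 ak1 ak; split=> //; first exact: (stQ k (ltn _ k3)).1.
  have [[_ [_ prk]] _] := prQ k (ltnW (ltn _ k3)).
  by move=> g /prk[].
by case=> [|[|[|//]]] k3; apply: step.
Qed.

(** Three terms of a regular sequence cancel successively, so [relation_chain] would put 1 in the
    ideal they generate with [I_X X]. *)
Lemma depth_le2 X f : (forall P, P \in X -> nzP1 P.1 && nzP1 P.2) ->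
  regular_seq (I_X X) f -> (size f <= 2)%N.
Proof.
move=> nzX [_ [regf nf]]; rewrite leqNgt; apply/negP => f3.
have hI := I_X_ideal X.
apply: nf; have [q [Iq sq]] :
    ideal_add (I_X X) (take 3 f) 1.
  apply: (@relation_chain (fun k => ideal_add (I_X X) (take k f)) (nth 0 f) X nzX).
  - by move=> p Ip; rewrite take0; apply/ideal_add_nil.
  - by move=> k _; apply: ideal_add_ideal.
  move=> k k3; have kf : (k < size f)%N by apply: leq_trans f3.
  rewrite (take_nth 0) //; split.
  - move=> p [q [Iq sq]]; exists q; split=> //; apply: ideal_gen_incl sq => g.
    by rewrite mem_rcons inE orbC => ->.
  - apply: ideal_add_r => //; apply: mem_ideal_gen.
    by rewrite mem_rcons mem_head.
  - exact: regf.
exists q; split=> //; apply: ideal_gen_incl sq => g; exact: mem_take.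
Qed.

Lemma staircase_ACM X As Bs lam :
  X != [::] -> (forall P, P \in X -> nzP1 P.1 && nzP1 P.2) ->
  all nzP1 As -> all nzP1 Bs ->
  (forall i j, i <= j -> lam j <= lam i)%N ->
  (forall p, I_X X p <-> stair Bs As lam p) ->
  ACM X.
Proof.
move=> X0 nzX /allP nzAs /allP nzBs lamP IE.
(* [c] and [d] avoid the staircase labels, as [stair_regular] requires, and the coordinates of the
   points, for cancellation in point ideals. *)
have [c nzc cfresh] := fresh_P1 (As ++ [seq P.1 | P <- X]).
have [d nzd dfresh] := fresh_P1 (Bs ++ [seq P.2 | P <- X]).
have hI := I_X_ideal X.
have [P PX] : exists P, P \in X.
  by case: (X) X0 => // P X' _; exists P; apply: mem_head.
have XcP Q : Q \in X -> ~~ sameP1 Q.1 c.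
  move=> QX; have /andP[nzQ _] := nzX Q QX; apply: cfresh => //.
  by rewrite mem_cat (map_f fst QX) orbT.
have XdP Q : Q \in X -> ~~ sameP1 Q.2 d.
  move=> QX; have /andP[_ nzQ] := nzX Q QX; apply: dfresh => //.
  by rewrite mem_cat (map_f snd QX) orbT.
have /andP[nzP1' nzP2'] := nzX P PX.
have addIE s p : ideal_add (I_X X) s p <-> ideal_add (stair Bs As lam) s p.
  by split=> [] [q [Iq sq]]; exists q; split=> //; apply/IE.
exists 2%N; split; split.
- exists [:: Hf c; Vf d]; split=> //; split; last split.
  + move=> g; rewrite in_cons mem_seq1 => /orP[] /eqP ->.
      exact: irrelevant_Hf.
    exact: irrelevant_Vf.
  + case=> [|[|//]] _ g /=.
      move/ideal_add_nil => IHg; apply/ideal_add_nil => Q QX.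
      have /andP[nz1 nz2] := nzX Q QX.
      exact: cancelHV_H nz1 nz2 (XcP Q QX) (IHg Q QX).
    move/addIE => h; apply/addIE; apply: stair_regular h => //.
      by move=> a aAs; apply: cfresh; rewrite ?mem_cat ?aAs // nzAs.
    by move=> b bBs; apply: dfresh; rewrite ?mem_cat ?bBs // nzBs.
  + case=> q [Iq sq]; have [_ [v1 _]] := vanish0_prime; apply: v1.
    rewrite -(subrK q 1); apply: (idealD vanish0_ideal) (vanish0_pt (Iq P PX)).
    apply: ideal_gen_sub vanish0_ideal _ _ sq => g.
    rewrite in_cons mem_seq1 => /orP[] /eqP ->.
      exact: vanish0_Hf.
    exact: vanish0_Vf.
- by move=> f; apply: depth_le2.
(* The chain is (H_P, V_P), (H_P, H_c, V_P), irrelevant ideal; [Hf c] and [Vf d] witness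
   strictness. *)
- have [u ua] := nzP1_dual nzP1'; have [w wb] := nzP1_dual nzP2'.
  have pr0 := kernel_prime (kernel_HV ua wb).
  have pr1 := kernel_prime (kernel_HHV (XcP P PX) wb).
  pose s0 := [:: Hf P.1; Vf P.2]; pose s1 := [:: Hf P.1; Hf c; Vf P.2].
  have sub01 p : ideal_gen s0 p -> ideal_gen s1 p.
    exact: (ideal_gen_incl (@sub_insert_second _ _ _ _)).
  have sub12 p : ideal_gen s1 p -> vanish0 p.
    apply: ideal_gen_sub vanish0_ideal _ _ => g.
    rewrite 2!in_cons mem_seq1 => /or3P[] /eqP ->.
    - exact: vanish0_Hf.
    - exact: vanish0_Hf.
    - exact: vanish0_Vf.
  (* The default value of [nth] serves as the third prime. *)
  exists (nth vanish0 [:: ideal_gen s0; ideal_gen s1]); split.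
    case=> [|[|[|//]]] _; split=> //=.
    + by move=> p /(_ P PX).
    + by move=> p /(_ P PX) /sub01.
    + exact: vanish0_prime.
    + by move=> p /(_ P PX) /sub01 /sub12.
  case=> [|[|//]] _; split=> //=.
    exists (Hf c); split; first exact: (mem_ideal_gen (mem_second _ _ _)).
    move=> h; have [_ [n1 _]] := pr0; apply: n1.
    by apply: (cancelHV_H nzP1' nzP2' (XcP P PX)); rewrite mulr1.
  exists (Vf d); split; first exact: vanish0_Vf.
  move=> h; have [_ [n1 _]] := pr1; apply: n1.
  by apply: (cancelHHV_V (XcP P PX) nzP2' (XdP P PX)); rewrite mulr1.
- by move=> m Q; apply: dim_le2.
Qed.

(** * Ideals generated by products of initial rulings *)

Lemma find_iota_mono (q : pred nat) n j :
  (forall i k, (i <= k)%N -> q i -> q k) -> (j < n)%N ->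
  q j = (find q (iota 0 n) <= j)%N.
Proof.
move=> qP jn; apply/idP/idP => [qj|].
  rewrite leqNgt; apply/negP => /(before_find 0%N).
  by rewrite nth_iota // add0n qj.
move=> fj; apply: qP (fj) _.
have hq : has q (iota 0 n) by rewrite has_find size_iota (leq_ltn_trans fj).
by have := nth_find 0%N hq; rewrite nth_iota ?add0n // (leq_ltn_trans fj).
Qed.

Lemma find_iota_le (q : pred nat) n : (find q (iota 0 n) <= n)%N.
Proof. by rewrite -{2}(size_iota 0 n) find_size. Qed.

Lemma mem_take_nth n (s : seq P1pt) x : x \in take n s ->
  exists i, [/\ (i < n)%N, (i < size s)%N & x = nth P1zero s i].
Proof.
move=> xs; case: (elimT (nthP P1zero) xs) => i; rewrite size_take_min leq_min => /andP[il iS] <-.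
by exists i; rewrite nth_take.
Qed.

Definition upset (U : nat -> nat -> bool) : Prop :=
  forall i j i' j', (i <= i')%N -> (j <= j')%N -> U i j -> U i' j'.

Lemma upset_corner U h v : upset U -> U h v -> exists a b lam,
  [/\ (a <= h)%N, (b <= v)%N, forall i, U i v = (a <= i)%N &
      forall j, U h j = (b <= j)%N] /\
  [/\ forall i j, (i <= j)%N -> (lam j <= lam i)%N,
      forall i, (lam i <= v - b)%N &
      forall i j, (j < v - b)%N -> U (a + i)%N (b + j)%N = (lam i <= j)%N].
Proof.
move=> Uup Uhv.
pose a := find (U^~ v) (iota 0 h); pose b := find (U h) (iota 0 v).
exists a, b, (fun i => find (fun j => U (a + i)%N (b + j)%N) (iota 0 (v - b))).
split; split; try exact: find_iota_le.
- move=> i; have [ih|hi] := ltnP i h.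
    by apply: find_iota_mono ih => k l kl; apply: Uup.
  by rewrite (leq_trans (find_iota_le _ _) hi) (Uup h v).
- move=> j; have [jv|vj] := ltnP j v.
    by apply: find_iota_mono jv => k l kl; apply: Uup.
  by rewrite (leq_trans (find_iota_le _ _) vj) (Uup h v).
- by move=> i j ij; apply: sub_find => k; apply: Uup; rewrite ?leq_add2l.
- by move=> i; exact: find_iota_le.
move=> i j jv; apply: (@find_iota_mono (fun j => U (a + i)%N (b + j)%N)) jv.
by move=> k l kl; apply: Uup; rewrite ?leq_add2l.
Qed.

Lemma prodH_factor As s i : (s <= i)%N -> exists r, prodH As i = r * prodH As s.
Proof.
move=> si; rewrite /prodH -(subnKC si) takeD big_cat /= mulrC.
by exists (\prod_(a <- take (i - s) (drop s As)) Hf a).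
Qed.

Lemma prodV_factor Bs s i : (s <= i)%N -> exists r, prodV Bs i = r * prodV Bs s.
Proof.
move=> si; rewrite /prodV -(subnKC si) takeD big_cat /= mulrC.
by exists (\prod_(a <- take (i - s) (drop s Bs)) Vf a).
Qed.

(** Forms of distinct rulings are pairwise coprime, so they split off one at a time. *)
Lemma rulings_factor s t p : distinctP1 s -> distinctP1 t ->
  (forall a, a \in s -> ideal_gen [:: Hf a] p) ->
  (forall b, b \in t -> ideal_gen [:: Vf b] p) ->
  exists q, p = (\prod_(a <- s) Hf a) * (\prod_(b <- t) Vf b) * q.
Proof.
elim: s p => [|a s IH] p.
  move=> _ dt _; rewrite big_nil; elim: t p dt => [|b t IH] p.
    by exists p; rewrite big_nil !mul1r.
  rewrite distinctP1_cons => /and3P[nzb /allP bt dt] pt.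
  have /ideal_gen1[q pE] := pt b (mem_head _ _).
  have [|r qE] := IH q dt.
    move=> b' b't; have /andP[/allP nzt _] := dt.
    apply: (cancelV_V (nzt _ b't) (b' := b)).
      by rewrite sameP1_sym; apply: bt.
    by rewrite mulrC -pE; apply: pt; rewrite in_cons b't orbT.
  by exists r; rewrite big_cons pE qE; clear; move: (\prod_(_ <- _) _) (Vf b); move=> *; ring.
rewrite distinctP1_cons => /and3P[nza /allP as' ds] dt ps pt.
have /ideal_gen1[q pE] := ps a (mem_head _ _).
have [||r qE] := IH q ds dt.
- move=> a' a's; have /andP[/allP nzs _] := ds.
  apply: (cancelH_H (nzs _ a's) (a' := a)).
    by rewrite sameP1_sym; apply: as'.
  by rewrite mulrC -pE; apply: ps; rewrite in_cons a's orbT.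
- move=> b bt; have /andP[/allP nzt _] := dt.
  apply: (cancelV_H (nzt _ bt) nza).
  by rewrite mulrC -pE; apply: pt.
exists r; rewrite big_cons pE qE; clear.
by move: (\prod_(_ <- _) _) (\prod_(_ <- _) _) (Hf a) => *; ring.
Qed.

(** The induction replaces [I] by the colon ideal I : H_a, which contains the later generators
    stripped of H_a. *)
Lemma stair_sub (I : RR -> Prop) Bs As lam p : is_ideal I ->
  (forall i, (i < size As)%N -> I (prodH As i * prodV Bs (lam i))) ->
  I (prodH As (size As)) -> stair Bs As lam p -> I p.
Proof.
elim: As I lam p => [|a As IH] I lam p hI Ii Il.
  by move=> _; move: Il; rewrite /prodH big_nil => /(idealM p hI); rewrite mulr1.
have HE k : prodH (a :: As) k.+1 = Hf a * prodH As k by rewrite /prodH big_cons.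
case=> q [k [-> kI]]; refine (idealD hI (ideal_mulr _ hI _) _).
  by have := Ii 0%N isT; rewrite /prodH big_nil mul1r.
apply: (IH (fun p => I (Hf a * p))) kI.
- split; first by rewrite mulr0; apply: ideal0.
  split=> [x y Ix Iy|r x Ix]; first by rewrite mulrDr; apply: idealD.
  by rewrite mulrCA; apply: idealM.
- by move=> i lti; rewrite mulrA -HE; apply: (Ii i.+1).
- by rewrite -HE.
Qed.

(* Vanishing on the configuration cut out by the generators
   [prodH As s * prodV Bs t] with [(s, t)] in the up-set [U]; the point
   conditions on the rulings [i] with [~~ U i (size Bs)] are redundant. *)
Definition vanishes (As Bs : seq P1pt) (U : nat -> nat -> bool) (p : RR) : Prop :=
  [/\ forall i, (i < size As)%N -> ~~ U i (size Bs) ->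
        ideal_gen [:: Hf (nth P1zero As i)] p,
      forall j, (j < size Bs)%N -> ~~ U (size As) j ->
        ideal_gen [:: Vf (nth P1zero Bs j)] p &
      forall i j, (i < size As)%N -> (j < size Bs)%N -> ~~ U i j ->
        I_pt (nth P1zero As i, nth P1zero Bs j) p].

(** Conditions are imposed outside the up-set, and the complement of an intersection is the union of
    the complements. *)
Lemma vanishes_andb As Bs U U' p :
  vanishes As Bs (fun i j => U i j && U' i j) p <->
  vanishes As Bs U p /\ vanishes As Bs U' p.
Proof.
split=> [[H V HV]|[[H V HV] [H' V' HV']]].
  by split; split=> [i hi nU|j hj nU|i j hi hj nU];
     [apply: H | apply: V | apply: HV | apply: H | apply: V | apply: HV] => //;
     rewrite negb_and nU ?orbT.
by split=> [i hi|j hj|i j hi hj]; rewrite negb_and => /orP[];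
   [apply: H | apply: H' | apply: V | apply: V' | apply: HV | apply: HV'].
Qed.

Definition above (S : seq (nat * nat)) (i j : nat) : bool :=
  has (fun st => (st.1 <= i) && (st.2 <= j))%N S.

Lemma above_upset S : upset (above S).
Proof.
move=> i j i' j' ii jj; apply: sub_has => st /andP[si tj].
by rewrite (leq_trans si ii) (leq_trans tj jj).
Qed.

Lemma prodH_vanish As s i : (i < size As)%N -> (i < s)%N ->
  ideal_gen [:: Hf (nth P1zero As i)] (prodH As s).
Proof.
move=> hi is_; have ia : nth P1zero As i \in take s As.
  by rewrite -(nth_take P1zero is_) mem_nth // size_take; case: ifP.
rewrite /prodH (big_rem _ ia) /=; apply/ideal_gen1.
by exists (\prod_(a <- rem (nth P1zero As i) (take s As)) Hf a); rewrite mulrC.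
Qed.

Lemma prodV_vanish Bs s i : (i < size Bs)%N -> (i < s)%N ->
  ideal_gen [:: Vf (nth P1zero Bs i)] (prodV Bs s).
Proof.
move=> hi is_; have ia : nth P1zero Bs i \in take s Bs.
  by rewrite -(nth_take P1zero is_) mem_nth // size_take; case: ifP.
rewrite /prodV (big_rem _ ia) /=; apply/ideal_gen1.
by exists (\prod_(a <- rem (nth P1zero Bs i) (take s Bs)) Vf a); rewrite mulrC.
Qed.

Lemma prodH_add As a i : prodH As (a + i) = prodH As a * prodH (drop a As) i.
Proof. by rewrite /prodH takeD big_cat. Qed.

Lemma prodV_add Bs b j : prodV Bs (b + j) = prodV Bs b * prodV (drop b Bs) j.
Proof. by rewrite /prodV takeD big_cat. Qed.

Lemma distinctP1_take_drop n s : distinctP1 s ->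
  distinctP1 (take n s) /\ distinctP1 (drop n s).
Proof. by rewrite -{1}(cat_take_drop n s) distinctP1_cat => /and3P[]. Qed.

(** The rulings split off from [p] miss the points indexed [(a + i, b + j)], so they cancel in the
    conditions there, which [stairP] assembles. *)
Lemma vanishes_stair As Bs U a b lam p q :
  distinctP1 As -> distinctP1 Bs ->
  (forall i j, (i <= j)%N -> (lam j <= lam i)%N) ->
  (forall i j, (j < size Bs - b)%N -> U (a + i)%N (b + j)%N = (lam i <= j)%N) ->
  p = prodH As a * prodV Bs b * q -> vanishes As Bs U p ->
  stair (drop b Bs) (drop a As) lam q.
Proof.
move=> dA dB lamP lamU pE [_ _ HV].
have [_ dA'] := distinctP1_take_drop a dA.
have [_ dB'] := distinctP1_take_drop b dB.
apply/stairP => // i; rewrite size_drop => hi bb /mem_take_nth[j [jl]].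
rewrite size_drop => jv ->; rewrite !nth_drop.
have hi' : (a + i < size As)%N by rewrite -ltn_subRL.
have hj' : (b + j < size Bs)%N by rewrite -ltn_subRL.
have := HV _ _ hi' hj'; rewrite lamU // -ltnNge => /(_ jl).
rewrite /I_pt /= pE -mulrA => h.
have nzA := distinctP1_nz dA hi'; have nzB := distinctP1_nz dB hj'.
have other (s : seq P1pt) n k x : distinctP1 s -> (n + k < size s)%N ->
    x \in take n s -> ~~ sameP1 (nth P1zero s (n + k)) x.
  move=> ds nk /mem_take_nth[l [ln ls ->]]; apply: distinctP1_nth => //.
  by rewrite gtn_eqF // (leq_trans ln) ?leq_addr.
have {}h := @cancel_prod Hf _ _ _ _ h.
have {}h := @cancel_prod Vf _ _ _ _ (h _); apply: h => [x g xt|x g xt].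
  exact: cancelHV_V nzA nzB (other _ _ _ _ dB hj' xt).
exact: cancelHV_H nzA nzB (other _ _ _ _ dA hi' xt).
Qed.

(** If [(i, j)] is not above (s, t), then i < s or j < t, so H_i or V_j divides the generator with
    exponents (s, t). *)
Lemma gens_vanish As Bs S p :
  (forall st, st \in S -> (st.1 <= size As)%N /\ (st.2 <= size Bs)%N) ->
  ideal_gen [seq prodH As st.1 * prodV Bs st.2 | st <- S] p ->
  vanishes As Bs (above S) p.
Proof.
move=> Sle Sp.
split=> [i hi /hasPn nU|j hj /hasPn nU|i j hi hj /hasPn nU];
  (apply: ideal_gen_sub Sp; first exact: ideal_gen_ideal);
  move=> _ /mapP[st stS ->]; have := nU st stS; have [sh tv] := Sle st stS.
- rewrite tv andbT -ltnNge => is_.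
  exact: (ideal_mulr _ (ideal_gen_ideal _) (prodH_vanish hi is_)).
- rewrite sh /= -ltnNge => jt.
  exact: (idealM _ (ideal_gen_ideal _) (prodV_vanish hj jt)).
rewrite negb_and -!ltnNge => /orP[is_|jt].
  refine (ideal_mulr _ (ideal_gen_ideal _) (ideal_gen_incl _ (prodH_vanish hi is_))).
  by move=> g; rewrite mem_seq1 => /eqP ->; apply: mem_head.
refine (idealM _ (ideal_gen_ideal _) (ideal_gen_incl _ (prodV_vanish hj jt))).
by move=> g; rewrite mem_seq1 => /eqP ->; apply: mem_second.
Qed.

(** Once the full rulings are split off, the cofactor lies in a staircase ideal. Its corner
    generators, multiplied back, have exponents in the up-set, hence are multiples of listed
    generators. *)
Lemma vanish_gens As Bs S p : distinctP1 As -> distinctP1 Bs ->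
  S != [::] -> (forall st, st \in S -> (st.1 <= size As)%N /\ (st.2 <= size Bs)%N) ->
  vanishes As Bs (above S) p ->
  ideal_gen [seq prodH As st.1 * prodV Bs st.2 | st <- S] p.
Proof.
move=> dA dB S0 Sle vp; have Uup := @above_upset S.
have Uhv : above S (size As) (size Bs).
  case: S S0 Sle {vp Uup} => // st S _ /(_ st (mem_head _ _))[h v].
  by rewrite /above /= h v.
have [a [b [lam [[ah bv Ua Ub] [lamP lamv lamU]]]]] := upset_corner Uup Uhv.
have [dtA _] := distinctP1_take_drop a dA.
have [dtB _] := distinctP1_take_drop b dB.
have [q pE] : exists q, p = prodH As a * prodV Bs b * q.
  case: vp => H V _; apply: rulings_factor => // x /mem_take_nth[i [il iS ->]].
    by apply: H => //; rewrite Ua -ltnNge.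
  by apply: V => //; rewrite Ub -ltnNge.
have stq := vanishes_stair dA dB lamP lamU pE vp.
have hI := ideal_gen_ideal [seq prodH As st.1 * prodV Bs st.2 | st <- S].
have multiple i j : above S i j ->
    ideal_gen [seq prodH As st.1 * prodV Bs st.2 | st <- S] (prodH As i * prodV Bs j).
  move=> /hasP[st stS /andP[/(prodH_factor As)[r rE] /(prodV_factor Bs)[r' r'E]]].
  rewrite rE r'E mulrACA; refine (idealM _ hI (mem_ideal_gen _)).
  exact: (map_f (fun st => prodH As st.1 * prodV Bs st.2) stS).
rewrite pE; move: stq.
apply: (@stair_sub (fun q => ideal_gen [seq prodH As st.1 * prodV Bs st.2 | st <- S]
   (prodH As a * prodV Bs b * q))).
- split; first by rewrite mulr0; apply: ideal0.
  split=> [x y Ix Iy|r x Ix]; first by rewrite mulrDr; apply: idealD.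
  by rewrite mulrCA; apply: idealM.
- move=> i; rewrite size_drop => hi.
  rewrite mulrACA -prodH_add -prodV_add; apply: multiple.
  (* In a full row [b + lam i] is [size Bs], and membership in the up-set comes from [Ua] instead of
     [lamU]. *)
  have [lt|] := ltnP (lam i) (size Bs - b); first by rewrite lamU.
  move=> le; rewrite (_ : b + lam i = size Bs)%N ?Ua ?leq_addr //.
  by have := lamv i; lia.
rewrite mulrAC -prodH_add size_drop subnKC //; apply: multiple.
by rewrite Ub.
Qed.

(** The lines are the first [a] horizontal and [b] vertical rulings; the points are the remaining
    cells outside [U], which form a staircase. *)
Lemma vanishes_ULAP As Bs U : distinctP1 As -> distinctP1 Bs ->
  upset U -> U (size As) (size Bs) ->
  exists W, is_ULAP W /\ forall p, vanishes As Bs U p <-> I_W W p.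
Proof.
move=> dA dB Uup Uhv.
have [a [b [lam [[ah bv Ua Ub] [lamP lamv lamU]]]]] := upset_corner Uup Uhv.
pose A := drop a As; pose B := drop b Bs.
have [dtA dA'] := distinctP1_take_drop a dA.
have [dtB dB'] := distinctP1_take_drop b dB.
pose cells := [seq ij <- [seq (i, j) | i <- iota 0 (size A), j <- iota 0 (size B)] |
  (ij.2 < lam ij.1)%N].
pose X : seq P1P1pt := [seq (nth P1zero A ij.1, nth P1zero B ij.2) | ij <- cells].
have cellsP i j : ((i, j) \in cells) = ((i < size A) && (j < size B) && (j < lam i))%N.
  rewrite mem_filter /= andbC; congr (_ && _).
  apply/allpairsP/andP => [[[i' j'] /= []]|[hi hj]].
    by rewrite !mem_iota => hi hj [-> ->].
  by exists (i, j); rewrite !mem_iota.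
have XP P : P \in X -> exists i j, [/\ (i < size A)%N, (j < size B)%N, (j < lam i)%N &
    P = (nth P1zero A i, nth P1zero B j)].
  case/mapP=> -[i j]; rewrite cellsP => /andP[/andP[hi hj] jl] ->.
  by exists i, j.
have nzX P : P \in X -> nzP1 P.1 && nzP1 P.2.
  by move=> /XP[i [j [hi hj _ ->]]]; rewrite /= !distinctP1_nz.
have XE p : I_X X p <-> stair B A lam p.
  rewrite stairP //; split=> [IX i hi c|IX P /XP[i [j [hi hj jl ->]]]].
    move=> /mem_take_nth[j [jl jB ->]]; apply: (IX (nth P1zero A i, nth P1zero B j)).
    by apply: (map_f (fun ij => (nth P1zero A ij.1, nth P1zero B ij.2)) (x := (i, j)));
       rewrite cellsP hi jB.
  apply: IX => //=; rewrite -(nth_take P1zero jl) mem_nth //.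
  by rewrite size_take_min leq_min jl.
have AcatB s n x y : distinctP1 s -> x \in take n s -> y \in drop n s -> ~~ sameP1 x y.
  by rewrite -{1}(cat_take_drop n s) distinctP1_cat => /and3P[/allrelP h _ _]; apply: h.
exists (MkULP X (take a As) (take b Bs)); split; first split.
- split; [exact: nzX | split; [|split; [|split; [|split; [|split; [|split]]]]]] => /=.
  + by case/andP: dtA => /allP.
  + by case/andP: dtB => /allP.
  + rewrite pairwise_map; have : uniq cells.
      by rewrite filter_uniq // allpairs_uniq ?iota_uniq // => -[? ?] [? ?] _ _ [-> ->].
    rewrite uniq_pairwise; apply: (@sub_in_pairwise _ [pred ij | ij \in cells]); last exact/allP.
    move=> [i j] [k l]; rewrite !inE /= !cellsP => /andP[/andP[iA jB] _] /andP[/andP[kA lB] _] /=.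
    rewrite xpair_eqE !negb_and => /orP[ik|jl].
      by rewrite distinctP1_nth.
    by rewrite (distinctP1_nth dB') ?orbT.
  + by case/andP: dtA.
  + by case/andP: dtB.
  + move=> P c /XP[i [j [hi hj _ ->]]] ct; rewrite /onH /=.
    by apply: (AcatB _ _ _ _ dA ct); apply: mem_nth.
  + move=> P c /XP[i [j [hi hj _ ->]]] ct; rewrite /onV /=.
    by apply: (AcatB _ _ _ _ dB ct); apply: mem_nth.
- rewrite /=; have [->|X0] := eqVneq X [::]; [by left | right].
  apply: (staircase_ACM X0 nzX _ _ lamP XE).
    by case/andP: dA'.
  by case/andP: dB'.
move=> p; rewrite /I_W /=; split=> [[H V HV]|[IX [H V]]].
  split; [|split].
  - move=> P /XP[i [j [hi hj jl ->]]]; rewrite !nth_drop.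
    rewrite !size_drop in hi hj.
    by apply: HV; rewrite -?ltn_subRL // lamU // -ltnNge.
  - move=> x /mem_take_nth[i [il iS ->]].
    by apply: H; rewrite ?Ua -?ltnNge.
  - move=> x /mem_take_nth[i [il iS ->]].
    by apply: V; rewrite ?Ub -?ltnNge.
have H' i : (i < size As)%N -> (i < a)%N -> ideal_gen [:: Hf (nth P1zero As i)] p.
  move=> hi ia; apply: H; rewrite -(nth_take P1zero ia) mem_nth //.
  by rewrite size_take_min leq_min ia.
have V' j : (j < size Bs)%N -> (j < b)%N -> ideal_gen [:: Vf (nth P1zero Bs j)] p.
  move=> hj jb; apply: V; rewrite -(nth_take P1zero jb) mem_nth //.
  by rewrite size_take_min leq_min jb.
split=> [i hi|j hj|i j hi hj nU].
- by rewrite Ua -ltnNge; apply: H'.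
- by rewrite Ub -ltnNge; apply: V'.
(* At a point on one of the lines the condition follows from that line; past both corners the cell
   belongs to [X]. *)
have [ia|ai] := ltnP i a.
  apply: ideal_gen_incl (H' i hi ia) => g.
  by rewrite mem_seq1 => /eqP ->; apply: mem_head.
have [jb|bj] := ltnP j b.
  apply: ideal_gen_incl (V' j hj jb) => g.
  by rewrite mem_seq1 => /eqP ->; apply: mem_second.
have jv : (j - b < size Bs - b)%N by rewrite ltn_sub2r // (leq_ltn_trans bj).
have jl : (j - b < lam (i - a))%N.
  by rewrite ltnNge -(lamU (i - a)%N _ jv) !subnKC.
have iv : (i - a < size As - a)%N by rewrite ltn_sub2r // (leq_ltn_trans ai).
rewrite -(subnKC ai) -(subnKC bj) -!nth_drop; apply: IX.
by apply: (map_f (fun ij => (nth P1zero A ij.1, nth P1zero B ij.2)) (x := (_, _)));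
   rewrite cellsP !size_drop iv jv.
Qed.

(** * Standard generators as products of initial rulings *)

Lemma prodH_cat s As i : (\prod_(a <- s) Hf a) * prodH As i = prodH (s ++ As) (size s + i).
Proof. by rewrite /prodH takeD big_cat take_size_cat // drop_size_cat. Qed.

Lemma prodV_cat s Bs j : (\prod_(b <- s) Vf b) * prodV Bs j = prodV (s ++ Bs) (size s + j).
Proof. by rewrite /prodV takeD big_cat take_size_cat // drop_size_cat. Qed.

Lemma prodH_min As i : prodH As i = prodH As (minn i (size As)).
Proof. by rewrite /prodH take_min take_size. Qed.

Lemma prodV_min Bs j : prodV Bs j = prodV Bs (minn j (size Bs)).
Proof. by rewrite /prodV take_min take_size. Qed.

(** With the lines of [W] placed before the labels, [Lambda W] is itself a product of initial
    rulings, and multiplying by it shifts both exponents. *)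
Lemma std_gens_prod W As Bs g : g \in std_gens W As Bs ->
  exists i j, [/\ (i <= size (hlines W ++ As))%N, (j <= size (vlines W ++ Bs))%N &
    g = prodH (hlines W ++ As) i * prodV (vlines W ++ Bs) j].
Proof.
case/mapP=> h hX ->.
have [i [j ->]] : exists i j, h = prodH As i * prodV Bs j.
  move: hX; rewrite mem_cat !inE => /orP[/orP[] /eqP ->|/mapP[k _ ->]].
  - by exists (size As), 0%N; rewrite /prodV take0 big_nil mulr1.
  - by exists 0%N, (size Bs); rewrite /prodH take0 big_nil mul1r.
  - by eexists; eexists.
(* [take] truncates, so capping an exponent by [minn] keeps the product and secures the bounds. *)
exists (size (hlines W) + minn i (size As))%N, (size (vlines W) + minn j (size Bs))%N.
split; rewrite ?size_cat ?leq_add2l ?geq_minr //.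
rewrite -prodH_cat -prodV_cat -prodH_min -prodV_min /Lambda; exact: mulrACA.
Qed.

Lemma std_gens_subset W As Bs G :
  {subset G <= std_gens W As Bs} ->
  exists S : seq (nat * nat),
    G = [seq prodH (hlines W ++ As) st.1 * prodV (vlines W ++ Bs) st.2 | st <- S] /\
    forall st, st \in S -> (st.1 <= size (hlines W ++ As))%N /\
                           (st.2 <= size (vlines W ++ Bs))%N.
Proof.
elim: G => [|g G IH] GS; first by exists [::].
have [|S [GE Sle]] := IH.
  by move=> h hG; apply: GS; rewrite in_cons hG orbT.
have [i [j [hi hj gE]]] := std_gens_prod (GS g (mem_head _ _)).
exists ((i, j) :: S); split; first by rewrite /= -gE -GE.
by move=> st; rewrite in_cons => /predU1P[->|/Sle].
Qed.

(** Each label in [s] carries a point of [X] while no line in [L] does, so no label repeats a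
    line. *)
Lemma distinct_lines_labels L s (T : eqType) (X : seq T) (on : P1pt -> T -> bool)
    (pr : T -> P1pt) :
  (forall c x, on c x = sameP1 c (pr x)) ->
  (forall c, c \in L -> nzP1 c) -> pairwise (fun c c' => ~~ sameP1 c c') L ->
  (forall c, c \in s -> nzP1 c) -> pairwise (fun c c' => ~~ sameP1 c c') s ->
  (forall c, c \in s -> has (on c) X) ->
  (forall x c, x \in X -> c \in L -> ~~ on c x) ->
  distinctP1 (L ++ s).
Proof.
move=> onE /allP nzL pwL nzs pws sX LX.
rewrite distinctP1_cat /distinctP1 nzL pwL pws andbT (introT allP nzs) /= andbT.
apply/allrelP => c c' cL c's; have /hasP[x xX c'x] := sX c' c's.
apply: contra (LX x c xX cL); rewrite !onE in c'x *.
by move/(sameP1_trans (nzs c' c's)); apply.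
Qed.

Theorem theorem4p8 (W : ULP) (As Bs : seq P1pt) (GA GB : seq RR) :
  is_ULAP W ->
  std_labeling (pts W) As Bs ->
  GA != [::] -> GB != [::] ->
  (forall g, (g \in std_gens W As Bs) = (g \in GA) || (g \in GB)) ->
  (forall g, g \in GA -> g \notin GB) ->
  exists W' : ULP, is_ULAP W' /\
    (forall p, (ideal_gen GA p /\ ideal_gen GB p) <-> I_W W' p).
Proof.
move=> [[_ [nzH [nzV [_ [pwH [pwV [PH PV]]]]]]] _].
move=> [nzA [pwA [_ [AX [_ [nzB [pwB [_ [BX _]]]]]]]]] GA0 GB0 GE _.
set A := hlines W ++ As; set B := vlines W ++ Bs.
have dA : distinctP1 A.
  exact: (@distinct_lines_labels _ _ _ (pts W) onH fst) _ nzH pwH nzA pwA AX PH.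
have dB : distinctP1 B.
  exact: (@distinct_lines_labels _ _ _ (pts W) onV snd) _ nzV pwV nzB pwB BX PV.
have [|SA [GAE SAle]] := @std_gens_subset W As Bs GA.
  by move=> g gA; rewrite GE gA.
have [|SB [GBE SBle]] := @std_gens_subset W As Bs GB.
  by move=> g gB; rewrite GE gB orbT.
have SA0 : SA != [::] by apply: contraNneq GA0 => SAE; rewrite GAE SAE.
have SB0 : SB != [::] by apply: contraNneq GB0 => SBE; rewrite GBE SBE.
have genE S p : S != [::] ->
    (forall st, st \in S -> (st.1 <= size A)%N /\ (st.2 <= size B)%N) ->
    ideal_gen [seq prodH A st.1 * prodV B st.2 | st <- S] p <->
    vanishes A B (above S) p.
  by move=> S0 Sle; split; [exact: gens_vanish | exact: vanish_gens].
have top S : S != [::] ->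
    (forall st, st \in S -> (st.1 <= size A)%N /\ (st.2 <= size B)%N) ->
    above S (size A) (size B).
  case: S => // st S _ /(_ st (mem_head _ _))[h v].
  by rewrite /above /= h v.
(* The configuration is that of the intersection of the two up-sets; the far corner lies in both
   because neither generating set is empty. *)
have [||W' [ulapW' W'E]] :=
  @vanishes_ULAP A B (fun i j => above SA i j && above SB i j) dA dB.
- move=> i j i' j' ii jj /andP[hA hB].
  by rewrite (above_upset ii jj hA) (above_upset ii jj hB).
- by rewrite !top.
exists W'; split=> // p; rewrite -W'E vanishes_andb GAE GBE.
by rewrite (genE SA) // (genE SB).
Qed.
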